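(* Let $A$ be an $M$-approximately unital Banach algebra. Then ${\mathfrak F}_A$ is weak* dense in ${\mathfrak F}_{A^{**}}$, and ${\mathfrak r}_A$ is weak* dense in ${\mathfrak r}_{A^{**}}$. Consequently $A$ has a contractive approximate identity contained in $\frac{1}{2}{\mathfrak F}_A=\{a\in A:\|1-2a\|_{A^1}\le 1\}$.
   Context: All Banach algebras are complex with $\|xy\|\le\|x\|\|y\|$; ''unital'' means having an identity of norm $1$. A Banach algebra is approximately unital if it has a contractive approximate identity (cai): a net $(e_t)$ with $\|e_t\|\le 1$ and $e_ta\to a$, $ae_t\to a$ for all $a$. For approximately unital $A$, the multiplier unitization $A^1$ is $A$ if $A$ is unital, and otherwise is $A+\mathbb{C}1$ with norm $\|a+\lambda 1\|=\sup\{\|ac+\lambda c\|: c\in A,\ \|c\|\le 1\}$ (i.e. $A+\mathbb{C}I\subset B(A)$ via left multiplication). A state of a unital Banach algebra $B$ is $\varphi\in B^*$ with $\|\varphi\|=\varphi(1)=1$. Define ${\mathfrak F}_A=\{a\in A:\|1-a\|_{A^1}\le 1\}$ and ${\mathfrak r}_A=\{a\in A:\mathrm{Re}\,\varphi(a)\ge 0$ for all states $\varphi$ of $A^1\}$. Biduals carry the second Arens product, and $A^{**}$ is identified with $A^{\perp\perp}\subset (A^1)^{**}$; ${\mathfrak F}_{A^{**}}=\{\eta\in A^{**}:\|1-\eta\|_{(A^1)^{**}}\le 1\}$ and ${\mathfrak r}_{A^{**}}=A^{**}\cap{\mathfrak r}_{(A^1)^{**}}$, where ${\mathfrak r}_{(A^1)^{**}}$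 is the set of elements of the unital Banach algebra $(A^1)^{**}$ at which every state has nonnegative real part. A subspace $E$ of a Banach space $X$ is an $M$-ideal if there is a projection $P$ of $X^{**}$ onto $E^{\perp\perp}$ with $\|\eta\|=\max\{\|P\eta\|,\|\eta-P\eta\|\}$ for all $\eta\in X^{**}$. $A$ is $M$-approximately unital if it is approximately unital and $A$ is an $M$-ideal in $A^1$. *)

(* Defs.v *)
From HB Require Import structures.
From mathcomp Require Import all_boot all_order all_algebra.
From mathcomp Require Import complex.
From mathcomp Require Import all_classical all_reals topology normedtype.
Set Implicit Arguments. Unset Strict Implicit. Unset Printing Implicit Defensive.
Import Order.TTheory GRing.Theory Num.Theory.
Import numFieldNormedType.Exports.
Local Open Scope ring_scope.
Local Open Scope classical_set_scope.

(* Complex Banach spaces "described concretely": a carrier, a         *)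
(* membership predicate (the actual vectors), a (semi)norm with real  *)
(* values, addition and complex scalar multiplication.  This is used  *)
(* to iterate the (continuous) dual construction X -> X^* .           *)

Section Spaces.
Variable R : realType.

Definition absC (z : R[i]) : R := complex.Re `|z|.

Record space := Space {
  car  : Type;
  mem  : car -> Prop;
  nrm  : car -> R;
  addv : car -> car -> car;
  sclv : R[i] -> car -> car }.

Definition is_dual (S : space) (f : car S -> R[i]) : Prop :=
  [/\ (forall x y, mem x -> mem y -> f (addv x y) = f x + f y),
      (forall (k : R[i]) x, mem x -> f (sclv k x) = k * f x) &
      (exists K : R, forall x, mem x -> absC (f x) <= K * nrm x)].

Definition dnorm (S : space) (f : car S -> R[i]) : R :=
  sup [set absC (f x) | x in [set x | mem x /\ nrm x <= 1]].

Definition dual (S : space) : space :=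
  @Space (car S -> R[i]) (@is_dual S) (@dnorm S)
    (fun f g x => f x + g x) (fun k f x => k * f x).

Definition ev (S : space) (x : car S) : car (dual (dual S)) := fun f => f x.

Definition perp (S : space) (E : car S -> Prop) (f : car (dual S)) : Prop :=
  is_dual f /\ forall x, E x -> f x = 0.

Definition perpperp (S : space) (E : car S -> Prop)
  (eta : car (dual (dual S))) : Prop :=
  @is_dual (dual S) eta /\ forall f, perp E f -> eta f = 0.

(* E is an M-ideal in S: there is a (linear) projection P of S^** onto
   E^perp perp with ||eta|| = max(||P eta||, ||eta - P eta||).
   Elements of S^** are functions on car (dual S), only their values on
   the genuine functionals (mem) matter; equalities are taken there. *)
Definition is_M_ideal (S : space) (E : car S -> Prop) : Prop :=
  let SS := dual (dual S) in
  let agree (u v : car SS) := forall f, @mem (dual S) f -> u f = v f in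
  exists P : car SS -> car SS,
    [/\ (forall u, mem u -> perpperp E (P u)),
        (forall u, perpperp E u -> agree (P u) u),
        (forall u v, mem u -> mem v -> agree u v -> agree (P u) (P v)) /\
        (forall u v, mem u -> mem v -> agree (P (addv u v)) (addv (P u) (P v))),
        (forall k u, mem u -> agree (P (sclv k u)) (sclv k (P u))) &
        (forall u, mem u ->
           nrm u = Num.max (nrm (P u)) (nrm (addv u (sclv (-1) (P u)))))].

Definition wstar_closure (S : space) (T : car S -> Prop)
  (eta : car (dual (dual S))) : Prop :=
  forall (n : nat) (fs : 'I_n -> car (dual S)),
    (forall i, @mem (dual S) (fs i)) ->
    forall eps : R, 0 < eps ->
      exists x, T x /\ forall i, absC (fs i x - eta (fs i)) < eps.

Definition wstar_dense (S : space) (T : car S -> Prop)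
  (U : car (dual (dual S)) -> Prop) : Prop :=
  (forall x, T x -> U (ev x)) /\ (forall eta, U eta -> wstar_closure T eta).

End Spaces.

Section BanachAlg.
Variables (R : realType) (A : completeNormedModType R[i]) (mul : A -> A -> A).

Definition nA (a : A) : R := complex.Re `|a|.

Definition is_banach_algebra : Prop :=
  [/\ (forall a b c, mul a (mul b c) = mul (mul a b) c),
      (forall a b c, mul (a + b) c = mul a c + mul b c) /\
      (forall a b c, mul a (b + c) = mul a b + mul a c),
      (forall (k : R[i]) a b, mul (k *: a) b = k *: mul a b),
      (forall (k : R[i]) a b, mul a (k *: b) = k *: mul a b) &
      (forall a b, nA (mul a b) <= nA a * nA b)].

Definition directed (I : Type) (le : I -> I -> Prop) : Prop :=
  [/\ (exists t : I, True), (forall t, le t t),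
      (forall s t u, le s t -> le t u -> le s u) &
      (forall s t, exists u, le s u /\ le t u)].

Definition net_conv (I : Type) (le : I -> I -> Prop) (f : I -> A) (l : A) :=
  forall eps : R, 0 < eps -> exists t0, forall t, le t0 t -> nA (f t - l) < eps.

Definition is_cai (I : Type) (le : I -> I -> Prop) (e : I -> A) : Prop :=
  [/\ directed le, (forall t, nA (e t) <= 1) &
      (forall a, net_conv le (fun t => mul (e t) a) a /\
                 net_conv le (fun t => mul a (e t)) a)].

Definition approx_unital : Prop :=
  exists (I : Type) (le : I -> I -> Prop) (e : I -> A), is_cai le e.

(* The multiplier unitization A^1: the element a + lambda 1 is represented
   by the pair (a, lambda), with norm
      ||a + lambda 1|| = sup { ||a c + lambda c|| : c in A, ||c|| <= 1 }
   (A + C I inside B(A) via left multiplication; if A is unital with an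
   identity of norm 1, this is the norm of A itself, the pair (a,lambda)
   standing for a + lambda 1_A). *)
Definition unorm (x : A * R[i]) : R :=
  sup [set nA (mul x.1 c + x.2 *: c) | c in [set c | nA c <= 1]].

Definition A1 : space R :=
  @Space R (A * R[i]) (fun _ => True) unorm
    (fun x y => (x.1 + y.1, x.2 + y.2)) (fun k x => (k *: x.1, k * x.2)).

Definition one1 : car A1 := (0, 1).
Definition jA (a : A) : car A1 := (a, 0).
Definition inA (x : car A1) : Prop := exists a, x = jA a.

Definition M_approx_unital : Prop := approx_unital /\ is_M_ideal inA.

Definition is_state (S : space R) (u : car S) (phi : car (dual S)) : Prop :=
  [/\ @mem _ (dual S) phi, @nrm _ (dual S) phi = 1 & phi u = 1].

Definition FA (a : A) : Prop := unorm (- a, 1) <= 1.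

Definition rA (a : A) : Prop :=
  forall phi, is_state one1 phi -> 0 <= complex.Re (phi (jA a)).

(* (A^1)^** and A^** = A^perp perp inside it *)
Definition A1dd : space R := dual (dual A1).
Definition one1dd : car A1dd := ev one1.
Definition inAdd (eta : car A1dd) : Prop := perpperp inA eta.

Definition FAdd (eta : car A1dd) : Prop :=
  inAdd eta /\ @nrm _ A1dd (addv one1dd (sclv (-1) eta)) <= 1.

Definition rA1dd (eta : car A1dd) : Prop :=
  @mem _ A1dd eta /\
  forall Phi, is_state one1dd Phi -> 0 <= complex.Re (Phi eta).

Definition rAdd (eta : car A1dd) : Prop := inAdd eta /\ rA1dd eta.

End BanachAlg.

(* Main.v *)
Require Import Defs.
From HB Require Import structures.
From mathcomp Require Import all_boot all_order all_algebra.
From mathcomp Require Import complex.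
From mathcomp Require Import all_classical all_reals topology normedtype.
From mathcomp Require Import ring lra.
Import Order.TTheory GRing.Theory Num.Theory.
Import numFieldNormedType.Exports.
Local Open Scope ring_scope.

(* Write X for A^1 and z = P(1) for the image of the identity under the M-projection P.

   F_A: if eta in A** satisfies |1 - eta| <= 1, Goldstine's theorem gives a in A close
   to eta on finitely many functionals with |1 - a| <= 1 + eps.  The point mu of the
   segment from a to z at distance eps from a satisfies |z - mu| <= 1, hence
   |1 - mu| = max (|z - mu|, |1 - z|) <= 1; pulling mu back to A by Hahn-Banach
   separation improves a to a' with |1 - a'| <= 1 + eps / 2 and
   |a' - a| <= 3 eps / 2.  Iterating, a is within 3 eps of some b in F_A.

   r_A: if eta is accretive then for every e there is t > 0 with
   |1 - t eta| <= 1 + t e; the previous argument applied to t eta gives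
   elements of t^-1 F_A, which is contained in r_A.

   Approximate identity: |1 - 2 z| = max (|z|, |1 - z|) <= 1, so z is a weak* limit
   of (1/2) F_A.  Moreover z is the weak* limit of every approximate identity where
   this limit exists, so it acts as an identity on A, and convexity of (1/2) F_A
   turns weak into norm convergence. *)

(** * The real-valued modulus on the complex numbers *)

Lemma absCE (R : realType) (z : R[i]) : `|z| = (absC z)%:C%C.
Proof. by rewrite /absC normc_def. Qed.

Lemma absC_ge0 (R : realType) (z : R[i]) : 0 <= absC z.
Proof. by rewrite -ler0c -absCE. Qed.

Lemma absC0 (R : realType) : absC (0 : R[i]) = 0.
Proof. by rewrite /absC normr0. Qed.

Lemma absC1 (R : realType) : absC (1 : R[i]) = 1.
Proof. by rewrite /absC normr1. Qed.

Lemma absCN (R : realType) (z : R[i]) : absC (- z) = absC z.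
Proof. by rewrite /absC normrN. Qed.

Lemma absCM (R : realType) (x y : R[i]) : absC (x * y) = absC x * absC y.
Proof. by apply: complexI; rewrite rmorphM /= -!absCE normrM. Qed.

Lemma absCD (R : realType) (x y : R[i]) : absC (x + y) <= absC x + absC y.
Proof. by rewrite -lecR rmorphD /= -!absCE ler_normD. Qed.

Lemma absC_eq0 (R : realType) (x : R[i]) : absC x = 0 -> x = 0.
Proof. by move=> h; apply/eqP; rewrite -normr_eq0 absCE h. Qed.

Lemma absC_real (R : realType) (r : R) : absC r%:C%C = `|r|.
Proof. by rewrite /absC normc_def /= expr0n addr0 sqrtr_sqr. Qed.

Lemma absC_nneg (R : realType) (r : R) : 0 <= r -> absC r%:C%C = r.
Proof. by move=> r0; rewrite absC_real ger0_norm. Qed.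

Lemma ReD (R : realType) (x y : R[i]) :
  complex.Re (x + y) = complex.Re x + complex.Re y.
Proof. by case: x y => [a b] [c d]. Qed.

Lemma ReN (R : realType) (x : R[i]) : complex.Re (- x) = - complex.Re x.
Proof. by case: x. Qed.

Lemma ReZ (R : realType) (t : R) (x : R[i]) :
  complex.Re (t%:C%C * x) = t * complex.Re x.
Proof. by case: x => a b /=; rewrite mul0r subr0. Qed.

Lemma Re_le_absC (R : realType) (x : R[i]) : complex.Re x <= absC x.
Proof. by rewrite -lecR -absCE (le_trans _ (normc_ge_Re x))// lecR ler_norm. Qed.

(** Used to turn bounds on real parts into bounds on moduli, by rotating the argument of a
    functional. *)
Lemma absC_phase (R : realType) (z : R[i]) :
  exists k : R[i], absC k = 1 /\ k * z = (absC z)%:C%C.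
Proof.
have [->|z0] := eqVneq z 0; first by exists 1; rewrite absC1 mul1r absC0.
have n0 : absC z != 0 by apply: contra_neq z0; exact: absC_eq0.
exists ((absC z)%:C%C / z); split; last by rewrite divfK.
have : absC ((absC z)%:C%C / z) * absC z = absC z.
  by rewrite -absCM divfK // absC_nneg // absC_ge0.
by move=> h; apply: (mulIf n0); rewrite h mul1r.
Qed.

(** * Sublinear functionals, Hahn-Banach extension and separation *)

Section HahnBanach.
Variables (R : realType) (V : lmodType R[i]) (M : V -> Prop).

(** Everything is relative to a predicate [M] on an ambient module, because the carrier of a dual is
    a full function space in which [mem] singles out the bounded functionals. *)
Definition subspace : Prop :=
  [/\ M 0, forall x y, M x -> M y -> M (x + y) &
      forall (k : R[i]) x, M x -> M (k *: x)].

(** Inequalities suffice and are easy to check for infima; [sublinear0] and [sublinearZ] recover the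
    equalities. *)
Definition sublinear (q : V -> R) : Prop :=
  [/\ q 0 <= 0, forall x y, M x -> M y -> q (x + y) <= q x + q y &
      forall (t : R) x, 0 < t -> M x -> q (t%:C%C *: x) <= t * q x].

Definition seminorm (p : V -> R) : Prop :=
  (forall x y, M x -> M y -> p (x + y) <= p x + p y) /\
  (forall (k : R[i]) x, M x -> p (k *: x) = absC k * p x).

Hypothesis subM : subspace.

Let M0 : M 0. Proof. by case: subM. Qed.
Let MD x y : M x -> M y -> M (x + y). Proof. by case: subM => _ + _; apply. Qed.
Let MZ k x : M x -> M (k *: x). Proof. by case: subM => _ _; apply. Qed.
Let MN x : M x -> M (- x). Proof. by rewrite -scaleN1r; apply: MZ. Qed.

Lemma sublinearZ q t x : sublinear q -> 0 < t -> M x ->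
  q (t%:C%C *: x) = t * q x.
Proof.
move=> [_ _ qZ] t0 Mx; apply/eqP; rewrite eq_le qZ //=.
have := qZ t^-1 (t%:C%C *: x).
rewrite invr_gt0 t0 scalerA -rmorphM /= mulVf ?gt_eqF // scale1r.
by move=> /(_ isT (MZ _ _ Mx)); rewrite mulrC ler_pdivlMr // mulrC.
Qed.

Lemma sublinear0 q : sublinear q -> q 0 = 0.
Proof.
move=> [q0 qD _]; apply/eqP; rewrite eq_le q0 /=.
by have := qD 0 0 M0 M0; rewrite addr0; lra.
Qed.

Lemma sublinear_lb q x : sublinear q -> M x -> - q (- x) <= q x.
Proof.
move=> qs Mx; have q0 := sublinear0 _ qs; case: qs => _ qD _.
by have := qD x (- x) Mx (MN _ Mx); rewrite subrr q0; lra.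
Qed.

Section InfConv.
Variables (q : V -> R) (K : V -> R -> Prop).
Hypothesis q_sub : sublinear q.
Hypothesis K0 : K 0 0.
Hypothesis KD : forall c b c' b', K c b -> K c' b' -> K (c + c') (b + b').
Hypothesis KZ : forall (t : R) c b, 0 < t -> K c b -> K (t%:C%C *: c) (t * b).
Hypothesis KM : forall c b, K c b -> M c.
Hypothesis Kq : forall c b, K c b -> b <= q c.

(** A minorant of [q] built from a convex cone [K] of constraints: since [infconv (- c) <= - b] for
    each pair of [K], every linear functional below it is at least [b] at [c]. The hypothesis [Kq]
    keeps the infimum finite. *)
Definition infconv (x : V) : R :=
  inf [set r | exists c b, K c b /\ r = q (x + c) - b]%classic.

Let infconv_has_inf x : M x ->
  has_inf [set r | exists c b, K c b /\ r = q (x + c) - b]%classic.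
Proof.
move=> Mx; split; first by exists (q (x + 0) - 0), 0, 0.
exists (- q (- x)) => _ [c [b [Kcb ->]]].
case: q_sub => _ qD _; have := qD (x + c) (- x).
move=> /(_ (MD _ _ Mx (KM _ _ Kcb)) (MN _ Mx)); rewrite addrAC subrr add0r.
by have := Kq _ _ Kcb; lra.
Qed.

Lemma infconv_le x c b : M x -> K c b -> infconv x <= q (x + c) - b.
Proof.
move=> Mx Kcb; apply: ge_inf; first by case: (infconv_has_inf _ Mx).
by exists c, b.
Qed.

Let infconv_ex x (e : R) : M x -> 0 < e ->
  exists c b, K c b /\ q (x + c) - b < infconv x + e.
Proof.
move=> Mx e0; have [r [c [b [Kcb ->]]] h] := inf_adherent e0 (infconv_has_inf _ Mx).
by exists c, b.
Qed.

Lemma infconv_sublinear : sublinear infconv.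
Proof.
case: (q_sub) => q0 qD qZ; split.
- by apply: le_trans (infconv_le _ _ _ M0 K0) _; rewrite subr0 addr0.
- move=> x y Mx My; apply/ler_addgt0Pr => e e0.
  have e2 : 0 < e / 2 by lra.
  have [c [b [Kcb hx]]] := infconv_ex _ _ Mx e2.
  have [c' [b' [Kcb' hy]]] := infconv_ex _ _ My e2.
  have := infconv_le _ _ _ (MD _ _ Mx My) (KD _ _ _ _ Kcb Kcb').
  have := qD (x + c) (y + c') (MD _ _ Mx (KM _ _ Kcb)) (MD _ _ My (KM _ _ Kcb')).
  by rewrite addrACA; lra.
- move=> t x t0 Mx; apply/ler_addgt0Pr => e e0.
  have et : 0 < e / t by rewrite divr_gt0.
  have [c [b [Kcb hx]]] := infconv_ex _ _ Mx et.
  apply: le_trans (infconv_le _ _ _ (MZ _ _ Mx) (KZ _ _ _ t0 Kcb)) _.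
  rewrite -scalerDr (sublinearZ q) //; last exact: MD (KM _ _ Kcb).
  rewrite -mulrBr; have : t * (q (x + c) - b) < t * (infconv x + e / t).
    by rewrite ltr_pM2l.
  rewrite [X in _ < X]mulrDr [X in _ < _ + X]mulrC divfK ?gt_eqF //.
  by rewrite mulrBr => /ltW.
Qed.

End InfConv.

(** Zorn's lemma for the reversed pointwise order on sublinear minorants of [p]. They are normalized
    to 0 off [M], which makes the order antisymmetric. *)
Lemma minimal_sublinear (p : V -> R) : sublinear p ->
  exists q, [/\ sublinear q, forall x, M x -> q x <= p x &
    forall r, sublinear r -> (forall x, M x -> r x <= q x) ->
      forall x, M x -> r x = q x].
Proof.
move=> p_sub.
pose ok q := [/\ sublinear q, forall x, M x -> q x <= p x &
  forall x, ~ M x -> q x = 0].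
pose below (s t : {q | ok q}) := `[< forall x, proj1_sig t x <= proj1_sig s x >].
pose cut (q : V -> R) x := if pselect (M x) then q x else 0.
have cutE q x : M x -> cut q x = q x by rewrite /cut; case: pselect.
have ok_cut q : sublinear q -> (forall x, M x -> q x <= p x) -> ok (cut q).
  move=> [q0 qD qZ] qp; split; last by move=> x; rewrite /cut; case: pselect.
  - split; first by rewrite cutE.
    + by move=> x y Mx My; rewrite !cutE //; [exact: qD|exact: MD].
    + by move=> t x t0 Mx; rewrite !cutE //; [exact: qZ|exact: MZ].
  - by move=> x Mx; rewrite cutE // qp.
have [||||[q [qs qp q0]] qmax] := @Zorn {q | ok q} below.
- by move=> t; apply/asboolP.
- move=> r s t /asboolP rs /asboolP st; apply/asboolP => x.
  exact: le_trans (st x) (rs x).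
- move=> [s sok] [t tok] /asboolP st /asboolP ts; apply: eq_exist.
  apply/funext => x; apply/eqP; rewrite eq_le.
  by apply/andP; split; [exact: ts|exact: st].
- move=> A Atot; have [[s0 As0]|A0] := pselect (exists s, A s); last first.
    exists (exist _ _ (ok_cut p p_sub (fun x _ => lexx _))) => s As.
    by case: A0; exists s.
  pose S x := [set r | exists s, A s /\ r = proj1_sig s x]%classic.
  have Sinf x : M x -> has_inf (S x).
    move=> Mx; split; first by exists (proj1_sig s0 x), s0.
    exists (- p (- x)) => _ [s [As ->]]; case: (proj2_sig s) => ss sp _.
    by apply: le_trans (sublinear_lb _ _ ss Mx); rewrite lerN2 sp //; exact: MN.
  have inf_le x s : M x -> A s -> inf (S x) <= proj1_sig s x.
    move=> Mx As; apply: ge_inf; first by case: (Sinf _ Mx).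
    by exists s.
  have inf_ex x e : M x -> 0 < e -> exists s, A s /\ proj1_sig s x < inf (S x) + e.
    move=> Mx e0; have [_ [s [As ->]] h] := inf_adherent e0 (Sinf _ Mx).
    by exists s.
  have Isub : sublinear (fun x => inf (S x)).
    split.
    + by apply: le_trans (inf_le _ _ M0 As0) _; case: (proj2_sig s0) => -[].
    + move=> x y Mx My; apply/ler_addgt0Pr => e e0.
      have e2 : 0 < e / 2 by lra.
      have [s [As hs]] := inf_ex _ _ Mx e2.
      have [t [At ht]] := inf_ex _ _ My e2.
      have [[_ sD _] _ _] := proj2_sig s; have [[_ tD _] _ _] := proj2_sig t.
      (* By totality of the chain, the smaller of [s] and [t] is close to the infimum at both [x]
         and [y]. *)
      case: (Atot _ _ As At) => /asboolP st.
      * by have := inf_le _ _ (MD _ _ Mx My) At; have := tD _ _ Mx My;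
          have := st x; lra.
      * by have := inf_le _ _ (MD _ _ Mx My) As; have := sD _ _ Mx My;
          have := st y; lra.
    + move=> t x t0 Mx; apply/ler_addgt0Pr => e e0.
      have et : 0 < e / t by rewrite divr_gt0.
      have [s [As hs]] := inf_ex _ _ Mx et.
      apply: le_trans (inf_le _ _ (MZ _ _ Mx) As) _.
      have [[_ _ sZ] _ _] := proj2_sig s; apply: le_trans (sZ _ _ t0 Mx) _.
      have : t * proj1_sig s x < t * (inf (S x) + e / t) by rewrite ltr_pM2l.
      by rewrite mulrDr [X in _ < _ + X]mulrC divfK ?gt_eqF // => /ltW.
  have Ip x : M x -> inf (S x) <= p x.
    move=> Mx; apply: le_trans (inf_le _ _ Mx As0) _.
    by case: (proj2_sig s0) => _ + _; apply.
  exists (exist _ _ (ok_cut _ Isub Ip)) => s As; apply/asboolP => x /=.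
  rewrite /cut; case: pselect => Mx; first exact: inf_le.
  by case: (proj2_sig s) => _ _ ->.
exists q; split => // r rs rq x Mx.
have rp y : M y -> r y <= p y by move=> My; apply: le_trans (rq _ My) (qp _ My).
have := qmax (exist _ _ (ok_cut r rs rp)).
have -> : below (exist _ q (And3 qs qp q0)) (exist _ _ (ok_cut r rs rp)).
  apply/asboolP => y /=; rewrite /cut; case: pselect => My; first exact: rq.
  by rewrite q0.
by move=> /(_ isT) [<-]; rewrite cutE.
Qed.

(* A minimal sublinear functional is linear: for fixed y, the functional
   x |-> inf_(t >= 0) q (x + t y) - t q y is sublinear and below q, so it equals q
   and q x + q y <= q (x + y). *)
Lemma minimal_sublinear_additive (q : V -> R) : sublinear q ->
  (forall r, sublinear r -> (forall x, M x -> r x <= q x) ->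
     forall x, M x -> r x = q x) ->
  forall x y, M x -> M y -> q (x + y) = q x + q y.
Proof.
move=> qs qmin x y Mx My.
pose K (c : V) (b : R) := exists t : R, [/\ 0 <= t, c = t%:C%C *: y & b = t * q y].
have K0 : K 0 0 by exists 0; rewrite scale0r mul0r.
have KD c b c' b' : K c b -> K c' b' -> K (c + c') (b + b').
  move=> [t [t0 -> ->]] [s [s0 -> ->]]; exists (t + s).
  by rewrite addr_ge0 // rmorphD /= scalerDl mulrDl.
have KZ (t : R) c b : 0 < t -> K c b -> K (t%:C%C *: c) (t * b).
  move=> t0 [s [s0 -> ->]]; exists (t * s).
  by rewrite mulr_ge0 // ?ltW // rmorphM /= scalerA mulrA.
have KM c b : K c b -> M c by move=> [t [_ -> _]]; exact: MZ.
have Kq c b : K c b -> b <= q c.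
  move=> [t [t0 -> ->]]; have [->|tn0] := eqVneq t 0.
    by rewrite scale0r mul0r sublinear0.
  by rewrite (sublinearZ q) // lt_def tn0.
have icM z c b := infconv_le q K qs K0 KM Kq z c b.
have ic_sub := infconv_sublinear q K qs K0 KD KZ KM Kq.
case: (qs) => _ qD _; apply/eqP; rewrite eq_le qD //=.
rewrite -(qmin _ ic_sub); last exact: Mx.
  have K1 : K y (q y) by exists 1; rewrite scale1r mul1r ler01.
  by have := icM x y (q y) Mx K1; lra.
by move=> z Mz; have := icM z 0 0 Mz K0; rewrite addr0 subr0.
Qed.

Lemma hahn_banach (p : V -> R) : sublinear p ->
  exists f : V -> R, [/\ forall x y, M x -> M y -> f (x + y) = f x + f y,
    forall (t : R) x, M x -> f (t%:C%C *: x) = t * f x &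
    forall x, M x -> f x <= p x].
Proof.
move=> ps; have [f [fs fp fmin]] := minimal_sublinear _ ps.
have fD := minimal_sublinear_additive _ fs fmin.
have f0 := sublinear0 _ fs.
have fN x : M x -> f (- x) = - f x.
  move=> Mx; have := fD x (- x) Mx (MN _ Mx); rewrite subrr f0; lra.
exists f; split => // t x Mx; have [t0|t0|->] := ltgtP t 0.
- have tN : 0 < - t by rewrite oppr_gt0.
  have -> : f (t%:C%C *: x) = - f ((- t)%:C%C *: x).
    by rewrite rmorphN /= scaleNr fN ?opprK //; exact: MZ.
  by rewrite (sublinearZ f) // mulNr opprK.
- exact: sublinearZ.
- by rewrite scale0r mul0r f0.
Qed.

Lemma seminorm_ge0 p x : seminorm p -> M x -> 0 <= p x.
Proof.
move=> [pD pZ] Mx; have := pD x (- x) Mx (MN _ Mx).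
rewrite subrr -(scale0r 0) (pZ _ 0) // absC0 mul0r -scaleN1r pZ //.
by rewrite absCN absC1 mul1r; lra.
Qed.

Lemma seminorm_sublinear p : seminorm p -> sublinear p.
Proof.
move=> [pD pZ]; split => //; first by rewrite -(scale0r 0) pZ // absC0 mul0r.
by move=> t x t0 Mx; rewrite pZ // absC_nneg // ltW.
Qed.

(** The usual complexification $F(x) = f(x) - i f(ix)$ of a real functional $f \le r$; rotating $x$
    gives the modulus bound. Two majorants are kept: [p] controls moduli, while the sharper [r]
    controls real parts. *)
Lemma hahn_banach_complex (p r : V -> R) : seminorm p -> sublinear r ->
  (forall x, M x -> r x <= p x) ->
  exists F : V -> R[i],
    [/\ forall x y, M x -> M y -> F (x + y) = F x + F y,
        forall k x, M x -> F (k *: x) = k * F x,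
        forall x, M x -> absC (F x) <= p x &
        forall x, M x -> complex.Re (F x) <= r x].
Proof.
move=> [pD pZ] rs rp; have [f [fD fZ fr]] := hahn_banach _ rs.
pose F x : R[i] := Complex (f x) (- f ('i%C *: x)).
have FD x y : M x -> M y -> F (x + y) = F x + F y.
  move=> Mx My; rewrite /F scalerDr !fD // ?opprD //; exact: MZ.
have FZ k x : M x -> F (k *: x) = k * F x.
  move=> Mx; have Mi : M ('i%C *: x) by exact: MZ.
  case: k => a b.
  have -> : Complex a b *: x = a%:C%C *: x + b%:C%C *: ('i%C *: x).
    by rewrite scalerA -scalerDl; congr (_ *: _); apply/eqP; rewrite eq_complex /=;
       apply/andP; split; apply/eqP; ring.
  rewrite FD; try exact: MZ.
  have e1 (t : R) y : M y -> F (t%:C%C *: y) = t%:C%C * F y.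
    move=> My; rewrite /F scalerA mulrC -scalerA !fZ //; last exact: MZ.
    by apply/eqP; rewrite eq_complex /=; apply/andP; split; apply/eqP; ring.
  rewrite !e1 //.
  have -> : F ('i%C *: x) = 'i%C * F x.
    rewrite /F scalerA.
    have -> : ('i%C * 'i%C : R[i]) = (-1 : R)%:C%C.
      by rewrite -expr2 sqr_i rmorphN1.
    rewrite fZ //; apply/eqP; rewrite eq_complex /=.
    by apply/andP; split; apply/eqP; ring.
  rewrite mulrA -mulrDl; congr (_ * _); apply/eqP; rewrite eq_complex /=.
  by apply/andP; split; apply/eqP; ring.
exists F; split => //.
move=> x Mx; have [k [k1 kF]] := absC_phase _ (F x).
have Mk : M (k *: x) by exact: MZ.
have -> : absC (F x) = f (k *: x).
  by rewrite -[LHS]/(complex.Re ((absC (F x))%:C%C)) -kF -FZ.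
by apply: le_trans (fr _ Mk) _; apply: le_trans (rp _ Mk) _; rewrite pZ // k1 mul1r.
Qed.

Definition convex_in (C : V -> Prop) : Prop :=
  forall (s t : R) x y, 0 < s -> 0 < t -> s + t = 1 -> C x -> C y ->
    C (s%:C%C *: x + t%:C%C *: y).

(* Hahn-Banach separation, in the form given by Mazur and Orlicz. *)
Lemma mazur_orlicz (p : V -> R) (C : V -> Prop) (b : R) :
  seminorm p -> (forall x, C x -> M x) -> convex_in C ->
  (forall x, C x -> b <= p x) ->
  exists F : V -> R[i],
    [/\ forall x y, M x -> M y -> F (x + y) = F x + F y,
        forall k x, M x -> F (k *: x) = k * F x,
        forall x, M x -> absC (F x) <= p x &
        forall x, C x -> b <= complex.Re (F x)].
Proof.
move=> pn CM Cconv Cb; have ps := seminorm_sublinear _ pn.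
(* The cone generated by the pairs $(x, b)$ with $x$ in $C$; the bound $b \le p$ on $C$ enters as
   [Kp]. *)
pose K (c : V) (d : R) := (c = 0 /\ d = 0) \/
  exists (t : R) x, [/\ 0 < t, C x, c = t%:C%C *: x & d = t * b].
have K0 : K 0 0 by left.
have KD c d c' d' : K c d -> K c' d' -> K (c + c') (d + d').
  move=> [[-> ->]|[t [x [t0 Cx -> ->]]]]; first by rewrite !add0r.
  move=> [[-> ->]|[s [y [s0 Cy -> ->]]]].
    by rewrite !addr0; right; exists t, x.
  have ts : 0 < t + s by rewrite addr_gt0.
  have tsn : (t + s)%:C%C != 0 :> R[i].
    by apply/eqP => -[h]; rewrite h ltxx in ts.
  right; exists (t + s), ((t / (t + s))%:C%C *: x + (s / (t + s))%:C%C *: y).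
  split => //; last by rewrite mulrDl.
    apply: Cconv => //; rewrite ?divr_gt0 //.
    by rewrite -mulrDl divff // gt_eqF.
  by rewrite scalerDr !scalerA -!rmorphM /= ![(t + s) * _]mulrC !divfK // gt_eqF.
have KZ (t : R) c d : 0 < t -> K c d -> K (t%:C%C *: c) (t * d).
  move=> t0 [[-> ->]|[s [x [s0 Cx -> ->]]]].
    by left; rewrite scaler0 mulr0.
  right; exists (t * s), x; split => //; first by rewrite mulr_gt0.
    by rewrite scalerA rmorphM.
  by rewrite mulrA.
have KM c d : K c d -> M c.
  by move=> [[-> _]//|[s [x [s0 Cx -> _]]]]; apply/MZ/CM.
have Kp c d : K c d -> d <= p c.
  move=> [[-> ->]|[s [x [s0 Cx -> ->]]]]; first by rewrite sublinear0.
  by rewrite (sublinearZ p) // ?ler_pM2l // ?Cb //; exact: CM.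
have ic z c d := infconv_le p K ps K0 KM Kp z c d.
have ics := infconv_sublinear p K ps K0 KD KZ KM Kp.
have icp x : M x -> infconv p K x <= p x.
  by move=> Mx; have := ic x 0 0 Mx K0; rewrite addr0 subr0.
have [F [FD FZ Fp Fr]] := hahn_banach_complex _ _ pn ics icp.
exists F; split => // x Cx; have Mx := CM _ Cx.
have Kx : K x b by right; exists 1, x; rewrite scale1r mul1r.
(* $\mathrm{Re}\,F(-x) \le p(-x + x) - b = -b$. *)
have := Fr (- x) (MN _ Mx); have := ic (- x) x b (MN _ Mx) Kx.
rewrite addNr sublinear0 // -scaleN1r FZ // mulN1r ReN; lra.
Qed.

End HahnBanach.

(* With V := A * C, respectively a space of complex functions on it, A^1, its dual
   and its bidual are convertible to instances of this space. *)
Definition lspace (R : realType) (V : lmodType R[i]) (M : V -> Prop) (p : V -> R) :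
  Defs.space R := @Defs.Space R V M p (fun x y => x + y) (fun k x => k *: x).

(** * The dual of a seminormed space *)

Section Duals.
Variables (R : realType) (V : lmodType R[i]) (M : V -> Prop) (p : V -> R).
Hypotheses (subM : subspace R V M) (semp : seminorm R V M p).
Local Notation S := (lspace R V M p).
Local Notation D := (@is_dual R S).
Local Notation dn := (@dnorm R S).

Let M0 : M 0. Proof. by case: subM. Qed.
Let MZ k x : M x -> M (k *: x). Proof. by case: subM => _ _; apply. Qed.
Let MD x y : M x -> M y -> M (x + y). Proof. by case: subM => _ + _; apply. Qed.
Let p_ge0 x : M x -> 0 <= p x. Proof. exact: (seminorm_ge0 R V M). Qed.
Let pZ k x : M x -> p (k *: x) = absC k * p x.
Proof. by case: semp => _; apply. Qed.
Let p0 : p 0 = 0. Proof. by rewrite -(scale0r 0) pZ // absC0 mul0r. Qed.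

Lemma is_dualB (f : V -> R[i]) x y : D f -> M x -> M y -> f (x - y) = f x - f y.
Proof.
move=> [fD fZ _] Mx My; rewrite -scaleN1r [LHS]fD //; last exact: MZ.
by rewrite [f (_ *: _)]fZ // mulN1r.
Qed.

Lemma is_dual0 (f : V -> R[i]) : D f -> f 0 = 0.
Proof. by move=> [_ fZ _]; rewrite -(scale0r 0) [LHS]fZ // mul0r. Qed.

Let dual_has_sup (f : V -> R[i]) : D f ->
  has_sup [set absC (f x) | x in [set x : V | M x /\ p x <= 1]]%classic.
Proof.
move=> Df; have [_ _ [K fK]] := Df; split.
  by exists (absC (f 0)), 0 => //; rewrite /= p0 ler01.
exists `|K| => _ [x [Mx px] <-]; apply: le_trans (fK _ Mx) _.
apply: le_trans (_ : `|K| * p x <= _).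
  by rewrite ler_wpM2r ?p_ge0 // ler_norm.
by rewrite -[leRHS]mulr1 ler_wpM2l.
Qed.

Lemma dnorm_ub (f : V -> R[i]) (m : R) :
  (forall x, M x -> p x <= 1 -> absC (f x) <= m) -> dn f <= m.
Proof.
move=> h; apply: ge_sup; first by exists (absC (f 0)), 0 => //; rewrite /= p0 ler01.
by move=> _ [x [Mx px] <-]; exact: h.
Qed.

Lemma dnorm_ub_ball (f : V -> R[i]) (r s : R) : 0 < r -> D f ->
  (forall x, M x -> p x <= r -> absC (f x) <= s) -> r * dn f <= s.
Proof.
move=> r0 [_ fZ _] h; rewrite mulrC -ler_pdivlMr //; apply: dnorm_ub => x Mx px.
rewrite ler_pdivlMr // mulrC -(absC_nneg _ _ (ltW r0)) -absCM -[_ * f x]fZ //.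
apply: h; first exact: MZ.
by rewrite pZ // (absC_nneg _ _ (ltW r0)) -[leRHS]mulr1 ler_pM2l.
Qed.

Lemma dnorm_ge0 f : D f -> 0 <= dn f.
Proof.
move=> Df; apply: le_trans (absC_ge0 _ (f 0)) _.
apply: ub_le_sup; first by case: (dual_has_sup _ Df).
by exists 0 => //; rewrite /= p0 ler01.
Qed.

Lemma dual_le (f : V -> R[i]) x : D f -> M x -> absC (f x) <= dn f * p x.
Proof.
move=> Df Mx; have [_ fZ [K fK]] := Df; have [px0|px0] := eqVneq (p x) 0.
  (* A vector of seminorm 0 cannot be normalized; there the bound with [K] already forces [f x] to
     vanish. *)
  by have := fK x Mx; rewrite /= px0 !mulr0.
have px : 0 < p x by rewrite lt_def px0 p_ge0.
have ixr : 0 <= (p x)^-1 by rewrite invr_ge0 ltW.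
rewrite -ler_pdivrMr // mulrC -(absC_nneg _ _ ixr) -absCM -[_ * f x]fZ //.
apply: ub_le_sup; first by case: (dual_has_sup _ Df).
exists ((p x)^-1%:C%C *: x) => //; split; first exact: MZ.
by rewrite /= pZ // absC_nneg // mulVf.
Qed.

(** Together with [dnorm_seminorm], this makes the dual an instance of the same setting, so that the
    results here can be iterated to the bidual and to functionals on it. *)
Lemma is_dual_subspace : subspace R (V -> R[i]^o) D.
Proof.
split.
- split => [x y Mx My|k x Mx|] /=; rewrite ?addr0 ?mulr0 //.
  by exists 0 => x _; rewrite mul0r absC0.
- move=> f g Df Dg; have [fD fZ _] := Df; have [gD gZ _] := Dg; split => /=.
  + by move=> x y Mx My; rewrite [LHS](congr2 +%R (fD _ _ Mx My) (gD _ _ Mx My)) addrACA.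
  + by move=> k x Mx; rewrite [LHS](congr2 +%R (fZ k _ Mx) (gZ k _ Mx)) mulrDr.
  + exists (dn f + dn g) => x Mx; rewrite mulrDl; apply: le_trans (absCD _ _ _) _.
    by rewrite lerD // dual_le.
- move=> k f Df; have [fD fZ _] := Df; split => /=.
  + by move=> x y Mx My; rewrite [LHS](congr1 ( *%R k) (fD _ _ Mx My)) mulrDr.
  + by move=> l x Mx; rewrite [LHS](congr1 ( *%R k) (fZ l _ Mx)) mulrCA.
  + exists (absC k * dn f) => x Mx.
    by rewrite [X in absC X <= _]/(k * f x) absCM -mulrA ler_wpM2l ?absC_ge0 // dual_le.
Qed.

Lemma dnorm_seminorm : seminorm R (V -> R[i]^o) D dn.
Proof.
have scal_le k f : D f -> dn (fun x => k * f x) <= absC k * dn f.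
  move=> Df; apply: dnorm_ub => x Mx px; rewrite absCM ler_wpM2l ?absC_ge0 //.
  apply: le_trans (dual_le _ _ Df Mx) _.
  by rewrite -[leRHS]mulr1 ler_wpM2l ?dnorm_ge0.
split.
- move=> f g Df Dg; apply: dnorm_ub => x Mx px; apply: le_trans (absCD _ _ _) _.
  apply: lerD; apply: le_trans (dual_le _ _ _ Mx) _ => //.
    by rewrite -[leRHS]mulr1 ler_wpM2l ?dnorm_ge0.
  by rewrite -[leRHS]mulr1 ler_wpM2l ?dnorm_ge0.
- move=> k f Df; apply/eqP; rewrite eq_le scal_le //=.
  have [->|k0] := eqVneq k 0.
    by rewrite absC0 mul0r dnorm_ge0 //; case: is_dual_subspace => _ _; exact.
  have ak : 0 < absC k.
    by rewrite lt_def absC_ge0 andbT; apply: contra_neq k0; exact: absC_eq0.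
  have Dk : D (k *: (f : V -> R[i]^o)) by case: is_dual_subspace => _ _; exact.
  have := scal_le k^-1 _ Dk.
  have -> : (fun x => k^-1 * (k *: (f : V -> R[i]^o)) x) = f.
    by apply/funext => x; rewrite [X in _ * X]/(k * f x) mulKf.
  have -> : absC k^-1 = (absC k)^-1.
    apply: (mulIf (lt0r_neq0 ak)); rewrite mulVf ?gt_eqF // -absCM mulVf //.
    exact: absC1.
  by rewrite mulrC ler_pdivlMr // mulrC.
Qed.

End Duals.

(** * The bidual and Goldstine's theorem *)

Section Goldstine.
Variables (R : realType) (V : lmodType R[i]) (M : V -> Prop) (p : V -> R).
Hypotheses (subM : subspace R V M) (semp : seminorm R V M p).
Local Notation S := (lspace R V M p).
Local Notation D := (@is_dual R S).
Local Notation dn := (@dnorm R S).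

Lemma dual_subspace : subspace R (V -> R[i]^o) D.
Proof. exact: is_dual_subspace. Qed.

Lemma dual_seminorm : seminorm R (V -> R[i]^o) D dn.
Proof. exact: dnorm_seminorm. Qed.

Lemma bidual_subspace :
  subspace R ((V -> R[i]^o) -> R[i]^o) (@is_dual R (dual S)).
Proof. exact: (is_dual_subspace R _ _ _ dual_subspace dual_seminorm). Qed.

Lemma bidual_seminorm :
  seminorm R ((V -> R[i]^o) -> R[i]^o) (@is_dual R (dual S)) (@dnorm R (dual S)).
Proof. exact: (dnorm_seminorm R _ _ _ dual_subspace dual_seminorm). Qed.

Lemma bidual_le (u : (V -> R[i]) -> R[i]) f : @is_dual R (dual S) u -> D f ->
  absC (u f) <= @dnorm R (dual S) u * dn f.
Proof. exact: (dual_le R _ _ _ dual_subspace dual_seminorm). Qed.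

(** Replaces extensionality: elements of the bidual are functions on all of [V -> R[i]], but only
    their values on bounded functionals count. *)
Lemma bidual_eq_dnorm (u v : (V -> R[i]) -> R[i]) :
  (forall f, D f -> u f = v f) -> @dnorm R (dual S) u = @dnorm R (dual S) v.
Proof.
move=> uv; rewrite /dnorm; congr sup; apply/seteqP; split => _ [f [Df nf] <-].
  by exists f => //; rewrite uv.
by exists f => //; rewrite uv.
Qed.

Lemma ev_bidual x : M x -> @is_dual R (dual S) (@ev R S x).
Proof.
move=> Mx; split => //; exists (p x) => f Df; rewrite mulrC.
exact: (dual_le R V M p subM semp f x Df Mx).
Qed.

Lemma ev_le x : M x -> @dnorm R (dual S) (@ev R S x) <= p x.
Proof.
move=> Mx; apply: (dnorm_ub R _ _ _ dual_subspace dual_seminorm) => f Df nf.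
apply: le_trans (dual_le R V M p subM semp f x Df Mx) _.
by rewrite -[leRHS]mul1r ler_wpM2r // (seminorm_ge0 R V M).
Qed.

Lemma bidual_sum (u : (V -> R[i]) -> R[i]) (I : Type) (s : seq I) (c : I -> R[i])
    (f : I -> V -> R[i]) :
  @is_dual R (dual S) u -> (forall i, D (f i)) ->
  D (fun x => \sum_(i <- s) c i * f i x) /\
  u (fun x => \sum_(i <- s) c i * f i x) = \sum_(i <- s) c i * u (f i).
Proof.
move=> Du Df; have [D0 DD DZ] := dual_subspace; have [uD uZ _] := Du.
elim: s => [|i s [IHd IHu]].
  under eq_fun do rewrite big_nil; rewrite big_nil; split; first exact: D0.
  exact: (is_dual0 R _ _ _ dual_subspace u Du).
under eq_fun do rewrite big_cons; rewrite big_cons; split.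
  exact: (DD (c i *: (f i : V -> R[i]^o)) _ (DZ _ _ (Df i)) IHd).
rewrite -IHu -[c i * u (f i)](uZ _ _ (Df i)).
exact: (uD (c i *: (f i : V -> R[i]^o)) _ (DZ _ _ (Df i)) IHd).
Qed.

(** Otherwise the convex set of vectors $(f_i(y) - u(f_i))_i$, with $y$ in the $r$-ball, has
    $\ell^1$ norm at least $d$. A separating functional yields a combination $g$ of the $f_i$ with
    $\mathrm{Re}\,g(y) \ge \mathrm{Re}\,u(g) + d$ on the ball, whence $r\|g\| \le -\mathrm{Re}\,u(g)
    - d < |u(g)| \le r\|g\|$. *)
Lemma goldstine (I : finType) (u : (V -> R[i]) -> R[i]) (f : I -> V -> R[i])
    (r d : R) :
  @is_dual R (dual S) u -> 0 < r -> @dnorm R (dual S) u <= r ->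
  (forall i, D (f i)) -> 0 < d ->
  exists y, [/\ M y, p y <= r & forall i, absC (f i y - u (f i)) < d].
Proof.
move=> Du r0 ur Df d0; apply: contrapT => far.
have [_ MD MZ] := subM; have [pD pZ] := semp.
have [_ _ DZ] := dual_subspace.
pose W := {ffun I -> R[i]^o}.
pose q (v : W) := \sum_i absC (v i).
have q_sem : seminorm R W (fun _ => True) q.
  split => [x y _ _|k x _]; rewrite /q.
    by rewrite -big_split /=; apply: ler_sum => i _; rewrite ffunE absCD.
  by rewrite mulr_sumr; apply: eq_bigr => i _; rewrite ffunE absCM.
pose val y : W := [ffun i => f i y - u (f i)].
pose C (v : W) := exists y, [/\ M y, p y <= r & v = val y].
have C_conv : convex_in R W C.
  move=> s t _ _ s0 t0 st1 [x [Mx px ->]] [y [My py ->]].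
  exists (s%:C%C *: x + t%:C%C *: y); split.
  - by apply: MD; exact: MZ.
  - apply: le_trans (pD _ _ (MZ _ _ Mx) (MZ _ _ My)) _.
    rewrite !pZ // (absC_nneg _ _ (ltW s0)) (absC_nneg _ _ (ltW t0)) -[leRHS]mul1r -st1 mulrDl.
    by rewrite lerD // ler_pM2l.
  - apply/ffunP => i; rewrite !ffunE /=.
    have [fD fZ _] := Df i; rewrite [f i (_ + _)]fD; try exact: MZ.
    rewrite [f i (s%:C%C *: _)]fZ // [f i (t%:C%C *: _)]fZ //.
    rewrite /GRing.scale /= !mulrBr addrACA -opprD -mulrDl -rmorphD /= st1.
    by rewrite mul1r.
have Cq v : C v -> d <= q v.
  move=> [y [My py ->]]; rewrite leNgt; apply/negP => qd; apply: far.
  exists y; split => // i; apply: le_lt_trans qd.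
  rewrite /q (bigD1 i) //= ffunE lerDl sumr_ge0 // => j _; exact: absC_ge0.
have sT : subspace R W (fun _ => True) by [].
have [F [FD FZ _ Fd]] :=
  mazur_orlicz R W (fun _ => True) sT q C d q_sem (fun _ _ => Logic.I) C_conv Cq.
pose e i : W := [ffun j => (i == j)%:R].
have FE v : F v = \sum_i F (e i) * v i.
  have FS (s : seq I) : F (\sum_(i <- s) v i *: e i) = \sum_(i <- s) F (e i) * v i.
    elim: s => [|i s IHs]; last by rewrite !big_cons FD // IHs FZ // mulrC.
    by rewrite !big_nil -(scale0r 0) FZ // mul0r.
  rewrite -FS; congr F; apply/ffunP => j; rewrite sum_ffunE (bigD1 j) //=.
  rewrite big1 ?addr0 => [|i ij]; rewrite !ffunE ?eqxx ?(negPf ij).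
    by rewrite /GRing.scale /= mulr1.
  by rewrite scaler0.
pose g x := \sum_i F (e i) * f i x.
have [Dg ug] := bidual_sum u I (index_enum I) (fun i => F (e i)) f Du Df.
have gd y : M y -> p y <= r -> complex.Re (u g) + d <= complex.Re (g y).
  move=> My py; have := Fd (val y); rewrite FE.
  have -> : \sum_i F (e i) * val y i = g y - u g.
    rewrite /g ug -sumrB; apply: eq_bigr => i _; by rewrite ffunE mulrBr.
  by rewrite ReD ReN => h; have := h (ex_intro _ y (And3 My py erefl)); lra.
(* The bound [gd] is applied at $-ky$, where $k$ rotates $g(y)$ to its modulus. *)
have gs y : M y -> p y <= r -> absC (g y) <= - (complex.Re (u g) + d).
  move=> My py; have [k [k1 kg]] := absC_phase _ (g y).
  have [_ gZ _] := Dg; have Mk : M ((- k) *: y) by exact: MZ.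
  have := gd _ Mk; rewrite pZ // absCN k1 mul1r => /(_ py).
  rewrite [g (_ *: _)](gZ _ _ My) mulNr [k * _]kg ReN /=; lra.
have := dnorm_ub_ball R V M p subM semp g r _ r0 Dg gs.
have := bidual_le u g Du Dg; have := Re_le_absC _ (- u g); rewrite absCN ReN.
have : @dnorm R (dual S) u * dn g <= r * dn g.
  by rewrite ler_wpM2r // dnorm_ge0.
by have := absC_ge0 _ (u g); lra.
Qed.

End Goldstine.

(** * The multiplier unitization and its norm *)

Section Unitization.
Variables (R : realType) (A : completeNormedModType R[i]) (mul : A -> A -> A).
Hypothesis mulP : is_banach_algebra mul.

Local Notation V1 := (A * R[i]^o)%type.
Local Notation N := (unorm mul).

Lemma nAE (a : A) : `|a| = (nA a)%:C%C.
Proof. by rewrite /nA RRe_real // normr_real. Qed.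

Lemma nA_ge0 (a : A) : 0 <= nA a.
Proof. by rewrite -ler0c -nAE. Qed.

Lemma nA0 : nA (0 : A) = 0.
Proof. by rewrite /nA normr0. Qed.

Lemma nAZ k (a : A) : nA (k *: a) = absC k * nA a.
Proof. by apply: complexI; rewrite rmorphM /= -absCE -!nAE normrZ. Qed.

Lemma nAD (a b : A) : nA (a + b) <= nA a + nA b.
Proof. by rewrite -lecR rmorphD /= -!nAE ler_normD. Qed.

Lemma nAN (a : A) : nA (- a) = nA a.
Proof. by rewrite /nA normrN. Qed.

Lemma nA_eq0 (a : A) : nA a = 0 -> a = 0.
Proof. by move=> h; apply/eqP; rewrite -normr_eq0 nAE h. Qed.

Lemma mulADl a b c : mul (a + b) c = mul a c + mul b c.
Proof. by case: mulP => _ []. Qed.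

Lemma mulADr a b c : mul a (b + c) = mul a b + mul a c.
Proof. by case: mulP => _ []. Qed.

Lemma mulAZl k a b : mul (k *: a) b = k *: mul a b.
Proof. by case: mulP. Qed.

Lemma mulAZr k a b : mul a (k *: b) = k *: mul a b.
Proof. by case: mulP. Qed.

Lemma mulAA a b c : mul a (mul b c) = mul (mul a b) c.
Proof. by case: mulP. Qed.

Lemma nAM a b : nA (mul a b) <= nA a * nA b.
Proof. by case: mulP. Qed.

Definition lact (x : V1) (c : A) : A := mul x.1 c + x.2 *: c.

Lemma lactD x y c : lact (x + y) c = lact x c + lact y c.
Proof. by rewrite /lact mulADl scalerDl addrACA. Qed.

Lemma lactZ k x c : lact (k *: x) c = k *: lact x c.
Proof. by rewrite /lact mulAZl scalerDr scalerA. Qed.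

Lemma lactZr k x c : lact x (k *: c) = k *: lact x c.
Proof. by rewrite /lact mulAZr scalerDr !scalerA mulrC. Qed.

Lemma lact_le_sum x c : nA (lact x c) <= (nA x.1 + absC x.2) * nA c.
Proof.
by apply: le_trans (nAD _ _) _; rewrite mulrDl nAZ lerD2r nAM.
Qed.

Lemma unorm_ub (x : V1) (m : R) :
  (forall c, nA c <= 1 -> nA (lact x c) <= m) -> N x <= m.
Proof.
move=> h; apply: ge_sup.
  by exists (nA (lact x 0)), 0 => //; rewrite /= nA0 ler01.
by move=> _ [c c1 <-]; exact: h.
Qed.

Lemma unorm_ge (x : V1) c : nA c <= 1 -> nA (lact x c) <= N x.
Proof.
move=> c1; apply: ub_le_sup; last by exists c.
exists (nA x.1 + absC x.2) => _ [d d1 <-]; apply: le_trans (lact_le_sum x d) _.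
by rewrite -[leRHS]mulr1 ler_wpM2l // addr_ge0 ?nA_ge0 ?absC_ge0.
Qed.

Lemma lact_le (x : V1) c : nA (lact x c) <= N x * nA c.
Proof.
have [c0|c0] := eqVneq (nA c) 0.
  by rewrite (nA_eq0 _ c0) -(scale0r 0) lactZr !nAZ absC0 !mul0r mulr0.
have cp : 0 < nA c by rewrite lt_def c0 nA_ge0.
have ic : 0 <= (nA c)^-1 by rewrite invr_ge0 ltW.
rewrite -ler_pdivrMr // mulrC -{1}(absC_nneg _ _ ic) -nAZ -lactZr.
by apply: unorm_ge; rewrite nAZ absC_nneg // mulVf.
Qed.

Lemma unorm_ge0 (x : V1) : 0 <= N x.
Proof. by apply: le_trans (nA_ge0 _) (unorm_ge x 0 _); rewrite nA0 ler01. Qed.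

Lemma unit_subspace : subspace R V1 (fun _ => True).
Proof. by []. Qed.

Lemma unorm_seminorm : seminorm R V1 (fun _ => True) N.
Proof.
have le k x : N (k *: x) <= absC k * N x.
  apply: unorm_ub => c c1.
  by rewrite lactZ nAZ ler_wpM2l ?absC_ge0 ?unorm_ge.
split => [x y _ _|k x _].
  apply: unorm_ub => c c1; rewrite lactD; apply: le_trans (nAD _ _) _.
  by rewrite lerD ?unorm_ge.
apply/eqP; rewrite eq_le le /=; have [->|k0] := eqVneq k 0.
  by rewrite absC0 mul0r unorm_ge0.
have ak : 0 < absC k.
  by rewrite lt_def absC_ge0 andbT; apply: contra_neq k0; exact: absC_eq0.
have := le k^-1 (k *: x); rewrite scalerA mulVf // scale1r => h.
have : absC k * N x <= absC k * (absC k^-1 * N (k *: x)) by rewrite ler_pM2l.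
by rewrite mulrA -absCM divff // absC1 mul1r.
Qed.

Lemma unormD (x y : V1) : N (x + y) <= N x + N y.
Proof. by case: unorm_seminorm => + _; apply. Qed.

Lemma unormZ k (x : V1) : N (k *: x) = absC k * N x.
Proof. by case: unorm_seminorm => _; apply. Qed.

Lemma unormN (x : V1) : N (- x) = N x.
Proof. by rewrite -scaleN1r unormZ absCN absC1 mul1r. Qed.

Lemma unorm_embed a : N ((a, 0) : V1) <= nA a.
Proof.
apply: unorm_ub => c c1; apply: le_trans (lact_le_sum _ c) _ => /=.
by rewrite absC0 addr0 -[leRHS]mulr1 ler_wpM2l ?nA_ge0.
Qed.

Lemma unorm_scalar k : N ((0, k) : V1) <= absC k.
Proof.
apply: unorm_ub => c c1; apply: le_trans (lact_le_sum _ c) _ => /=.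
by rewrite nA0 add0r -[leRHS]mulr1 ler_wpM2l ?absC_ge0.
Qed.

(* Either the character (a, k) |-> k is bounded, or A is dense in A^1 and 0 serves. *)
Lemma almost_embed : exists f0 : V1 -> R[i],
  [/\ @is_dual R (A1 mul) f0, forall a, f0 (a, 0) = 0 &
  forall (d : R) v, 0 < d -> absC (f0 v) < d -> exists a, N (v - (a, 0)) <= d].
Proof.
have [[K hK]|noK] := pselect (exists K, forall x : V1, absC x.2 <= K * N x).
  exists snd; split => //; first by split => //; exists K => x _; exact: hK.
  move=> d [a k] d0 /= kd; exists a; apply: le_trans (ltW kd).
  have -> : ((a, k) : V1) - (a, 0) = (0, k).
    by congr (_, _); rewrite /= ?subrr ?subr0.
  exact: unorm_scalar.
exists (fun _ => 0); split => //.
  split => [x y _ _|k x _|]; rewrite ?addr0 ?mulr0 //.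
  by exists 0 => x _; rewrite mul0r absC0.
move=> d v d0 _; apply: contrapT => h; apply: noK; exists (absC v.2 / d) => x.
rewrite leNgt; apply/negP => xlt; apply: h.
have x2 : x.2 != 0.
  apply: contraTneq xlt => ->; rewrite absC0 -leNgt mulr_ge0 ?unorm_ge0 //.
  by rewrite divr_ge0 ?absC_ge0 ?ltW.
have ax : 0 < absC x.2.
  by rewrite lt_def absC_ge0 andbT; apply: contra_neq x2; exact: absC_eq0.
(* Some $x$ has a norm too small for its scalar part; the multiple of $x$ with the same scalar part
   as $v$ has norm at most $d$ and differs from $v$ by an element of $A$. *)
exists (v.1 - (v.2 / x.2) *: x.1).
have -> : v - (v.1 - (v.2 / x.2) *: x.1, 0) = (v.2 / x.2) *: x.
  case: v x {xlt ax} x2 => [a k] [b l] /= l0; congr (_, _) => /=.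
    by rewrite opprB addrC subrK.
  by rewrite subr0 /GRing.scale /= divfK.
rewrite unormZ -(ler_pM2r ax) mulrAC -absCM divfK //.
by rewrite ltW // -ltr_pdivrMl // mulrA [_^-1 * _]mulrC.
Qed.

Section Net.
Variables (I : Type) (le : I -> I -> Prop) (e : I -> A).
Hypothesis e_cai : is_cai mul le e.

Lemma cai_eventually (b c : A) (d : R) : 0 < d ->
  exists t, [/\ nA (e t) <= 1, nA (mul b (e t) - b) < d & nA (mul (e t) c - c) < d].
Proof.
move=> d0; have [[_ _ _ dir] e1 conv] := e_cai.
have [_ /(_ d d0)[t0 h0]] := conv b; have [/(_ d d0)[t1 h1] _] := conv c.
by have [t [lt0 lt1]] := dir t0 t1; exists t; split; [exact: e1|exact: h0|exact: h1].
Qed.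

(** $a e_t \to a$, so a uniform bound on the products passes to $a$. *)
Lemma nA_le_limit a (K : R) : (forall t, nA (e t) <= 1 -> nA (mul a (e t)) <= K) ->
  nA a <= K.
Proof.
move=> h; apply/ler_addgt0Pr => d d0; have [t [et ht _]] := cai_eventually a 0 _ d0.
have -> : a = mul a (e t) - (mul a (e t) - a) by rewrite opprB addrC subrK.
apply: le_trans (nAD _ _) _; rewrite nAN; apply: lerD; [exact: h|].
by apply: ltW.
Qed.

Lemma nA_le_unorm a : nA a <= N ((a, 0) : V1).
Proof.
apply: nA_le_limit => t et; apply: le_trans _ (unorm_ge _ _ et).
by rewrite /lact /= scale0r addr0.
Qed.

Lemma unorm_embedE a : N ((a, 0) : V1) = nA a.
Proof. by apply/eqP; rewrite eq_le unorm_embed nA_le_unorm. Qed.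

Definition ract (a : A) (x : V1) : A := mul a x.1 + x.2 *: a.

(** [unorm] is defined through left multiplication on $A$; it also controls right multiplication by
    $x$, because $(ax)e_t = a(x e_t)$. *)
Lemma ract_le a (x : V1) : nA (ract a x) <= nA a * N x.
Proof.
apply: nA_le_limit => t et.
have -> : mul (ract a x) (e t) = mul a (lact x (e t)).
  by rewrite /ract /lact mulADl mulADr mulAA mulAZl mulAZr.
by apply: le_trans (nAM _ _) _; rewrite ler_wpM2l ?nA_ge0 // unorm_ge.
Qed.

End Net.
End Unitization.

(** * Geometrically convergent sequences in a Banach space *)

Lemma small_pow (R : realType) (C d : R) : 0 < d -> exists n, C / 2 ^+ n < d.
Proof.
move=> d0; have h : `|C| / d < (Num.bound (`|C| / d))%:R.
  by apply: archi_boundP; rewrite divr_ge0 // ltW.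
exists (Num.bound (`|C| / d)); set n := Num.bound _ in h *.
have p2 : 0 < 2 ^+ n :> R by rewrite exprn_gt0.
rewrite ltr_pdivrMr //; apply: le_lt_trans (ler_norm C) _.
rewrite mulrC -ltr_pdivrMr //; apply: lt_trans h _.
by rewrite -natrX ltr_nat ltn_expl.
Qed.

Section Complete.
Variables (R : realType) (A : completeNormedModType R[i]).

Lemma geometric_limit (u : nat -> A) (C : R) :
  (forall n, nA (u n.+1 - u n) <= C / 2 ^+ n) ->
  exists l, forall n, nA (u n - l) <= 2 * C / 2 ^+ n.
Proof.
move=> hu; have C0 : 0 <= C.
  by have := le_trans (nA_ge0 _ _ _) (hu 0%N); rewrite expr0 divr1.
(* The subtracted tail of the geometric series makes the induction on [k] close. *)
have step n k : nA (u n - u (n + k)%N) <= 2 * C / 2 ^+ n - 2 * C / 2 ^+ (n + k).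
  elim: k => [|k IH]; first by rewrite addn0 !subrr nA0.
  rewrite addnS exprS.
  have -> : u n - u (n + k).+1 = (u n - u (n + k)%N) - (u (n + k).+1 - u (n + k)%N).
    by rewrite opprB addrA subrK.
  apply: (le_trans (nAD _ _ _ _)); rewrite nAN.
  have := hu (n + k)%N; have e2 : 2 ^+ (n + k) != 0 :> R by rewrite lt0r_neq0 // exprn_gt0.
  have -> : 2 * C / (2 * 2 ^+ (n + k)) = C / 2 ^+ (n + k) by field.
  rewrite -[2 * C / 2 ^+ (n + k)]mulrA in IH *; lra.
have step' n m : (n <= m)%N -> nA (u n - u m) <= 2 * C / 2 ^+ n.
  move=> nm; rewrite -(subnKC nm); apply: le_trans (step _ _) _.
  by rewrite gerBl divr_ge0 ?mulr_ge0 // exprn_ge0.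
(* Radii of balls live in [R[i]], where being positive includes being real. *)
have real_eps (eps : R[i]) : 0 < eps -> 0 < complex.Re eps /\ eps = (complex.Re eps)%:C%C.
  move=> e0; split; last by rewrite RRe_real // gtr0_real.
  by move: e0; rewrite ltcE => /andP[].
have : cvgn u.
  apply/cauchy_cvgP/cauchy_exP => eps /real_eps[e0 ->].
  have [n hn] := small_pow _ (2 * C) _ e0.
  exists (u n); exists n => // m /= nm; rewrite -ball_normE /= nAE ltcR.
  exact: le_lt_trans (step' _ _ nm) hn.
move=> /cvg_ex[l /cvgrPdist_lt ul]; exists l => n; apply/ler_addgt0Pr => d d0.
have d0' : 0 < d%:C%C :> R[i] by rewrite ltcR.
have [m0 _ hm] := ul _ d0'.
have := hm (maxn n m0) (leq_maxr _ _); rewrite /= nAE ltcR => h.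
have := step' n (maxn n m0) (leq_maxl _ _).
have -> : u n - l = (u n - u (maxn n m0)) - (l - u (maxn n m0)).
  by rewrite opprB addrA subrK.
by have := nAD _ _ (u n - u (maxn n m0)) (- (l - u (maxn n m0))); rewrite nAN; lra.
Qed.

End Complete.

(** * Approximating elements of $A^{**}$ from $A$ *)

Section MIdeal.
Variables (R : realType) (A : completeNormedModType R[i]) (mul : A -> A -> A).
Hypothesis mulP : is_banach_algebra mul.

Local Notation V1 := (A * R[i]^o)%type.
Local Notation N := (unorm mul).
Local Notation D := (@is_dual R (A1 mul)).
Local Notation dn := (@dnorm R (A1 mul)).
Local Notation B2 := (@is_dual R (dual (A1 mul))).
Local Notation bn := (@dnorm R (dual (A1 mul))).
Local Notation A2 := (@inAdd R A mul).
Local Notation one := ((0, 1) : V1).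
Local Notation emb a := ((a, 0) : V1).
Let N1 := unorm_seminorm R A mul mulP.
Let sub1 := unit_subspace R A.

Lemma D_add f x y : D f -> f (x + y) = f x + f y.
Proof. by case=> fD _ _; exact: fD. Qed.

Lemma D_scale f k (x : V1) : D f -> f (k *: x) = k * f x.
Proof. by case=> _ fZ _; exact: fZ. Qed.

Lemma D_sub f (x y : V1) : D f -> f (x - y) = f x - f y.
Proof. by move=> Df; exact: (is_dualB R V1 _ N sub1 f x y Df). Qed.

Lemma D_le f (x : V1) : D f -> absC (f x) <= dn f * N x.
Proof. by move=> Df; exact: (dual_le R V1 _ N sub1 N1 f x Df). Qed.

Lemma D_ge0 f : D f -> 0 <= dn f.
Proof. exact: (dnorm_ge0 R V1 _ N sub1 N1). Qed.

Lemma B2_lin k l u v : B2 u -> B2 v -> B2 (fun f => k * u f + l * v f).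
Proof.
move=> Bu Bv; have [_ BD BZ] := bidual_subspace R V1 _ N sub1 N1.
exact: (BD _ _ (BZ k u Bu) (BZ l v Bv)).
Qed.

Lemma B2_ev x : B2 (@ev R (A1 mul) x).
Proof. exact: (ev_bidual R V1 _ N sub1 N1). Qed.

Lemma bn_scale k u : B2 u -> bn (fun f => k * u f) = absC k * bn u.
Proof. by have [_ +] := bidual_seminorm R V1 _ N sub1 N1; apply. Qed.

Lemma bn_add u v : B2 u -> B2 v -> bn (fun f => u f + v f) <= bn u + bn v.
Proof. by have [+ _] := bidual_seminorm R V1 _ N sub1 N1; apply. Qed.

Lemma bn_eq (u v : (V1 -> R[i]) -> R[i]) :
  (forall f, D f -> u f = v f) -> bn u = bn v.
Proof. exact: (bidual_eq_dnorm R V1 _ N). Qed.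

Lemma bn_ev x : bn (@ev R (A1 mul) x) <= N x.
Proof. exact: (ev_le R V1 _ N sub1 N1). Qed.

Lemma A2_lin k l u v : A2 u -> A2 v -> A2 (fun f => k * u f + l * v f).
Proof.
move=> [Bu u0] [Bv v0]; split; first exact: B2_lin.
by move=> f pf; rewrite u0 // v0 // !mulr0 addr0.
Qed.

Lemma A2_ev a : A2 (@ev R (A1 mul) (jA mul a)).
Proof.
by split; [exact: B2_ev|move=> f [_ f0]; rewrite /ev f0 //; exists a].
Qed.

(** Goldstine is applied to $w - u$ with the functional [f0] of [almost_embed] adjoined as [None].
    As $u$ kills [f0], the resulting $y$ makes [f0 (w - y)] small, so $w - y$ is close in norm to an
    element of $A$. *)
Lemma approx_in_A (I : finType) (u : (V1 -> R[i]) -> R[i]) (w : V1)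
    (f : I -> V1 -> R[i]) (r d : R) :
  A2 u -> 0 < r -> bn (fun g => g w - u g) <= r -> (forall i, D (f i)) -> 0 < d ->
  exists a, N (w - emb a) <= r + d /\ forall i, absC (f i (emb a) - u (f i)) < d.
Proof.
move=> [Bu uA] r0 ur Df d0; have [f0 [Df0 f0A f0d]] := almost_embed R A mul mulP.
pose K := \sum_i dn (f i).
have Kf i : dn (f i) <= K.
  by rewrite /K (bigD1 i) //= lerDl sumr_ge0 // => j _; exact: D_ge0.
have K0 : 0 <= K by apply: sumr_ge0 => i _; exact: D_ge0.
(* Moving by $d'$ in norm changes each $f_i$ by at most $Kd'$, and $d' + Kd' = d$. *)
pose d' := d / (1 + K).
have d'0 : 0 < d' by rewrite divr_gt0 // ltr_pwDl.
have d'E : d' + K * d' = d by rewrite /d'; field; lra.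
have Kd' : 0 <= K * d' by rewrite mulr_ge0 // ltW.
pose g (i : option I) := if i is Some i then f i else f0.
have Dg i : D (g i) by case: i.
have Bv : B2 (fun h => h w - u h).
  have := B2_lin 1 (-1) _ _ (B2_ev w) Bu.
  by congr B2; apply/funext => h; rewrite mul1r mulN1r.
have [y [_ yr gy]] := goldstine R V1 _ N sub1 N1 _ _ g r d' Bv r0 ur Dg d'0.
have u0 : u f0 = 0 by apply: uA; split => // x [a ->]; exact: f0A.
have f0y : absC (f0 (w - y)) < d'.
  have := gy None; rewrite /= u0 subr0 -absCN opprB => h.
  by rewrite D_sub.
have [a Na] := f0d d' _ d'0 f0y; exists a; split.
  have -> : w - emb a = y + (w - y - emb a) by rewrite addrA [y + _]addrC subrK.
  by have := unormD R A mul mulP y (w - y - emb a); lra.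
move=> i; have fi := gy (Some i); rewrite /= in fi.
have -> : f i (emb a) - u (f i) =
    - ((f i y - (f i w - u (f i))) + f i (w - y - emb a)).
  by rewrite !D_sub //; ring.
rewrite absCN; have := absCD R (f i y - (f i w - u (f i))) (f i (w - y - emb a)).
have := D_le _ (w - y - emb a) (Df i).
have : dn (f i) * N (w - y - emb a) <= K * d'.
  by apply: ler_pM => //; [exact: D_ge0|exact: unorm_ge0].
lra.
Qed.

End MIdeal.

(** * The M-projection of the identity and the intersection of balls *)

Section MApproximatelyUnital.
Variables (R : realType) (A : completeNormedModType R[i]) (mul : A -> A -> A).
Hypothesis mulP : is_banach_algebra mul.

Local Notation V1 := (A * R[i]^o)%type.
Local Notation N := (unorm mul).
Local Notation D := (@is_dual R (A1 mul)).
Local Notation dn := (@dnorm R (A1 mul)).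
Local Notation B2 := (@is_dual R (dual (A1 mul))).
Local Notation bn := (@dnorm R (dual (A1 mul))).
Local Notation A2 := (@inAdd R A mul).
Local Notation one := ((0, 1) : V1).
Local Notation emb a := ((a, 0) : V1).
Let N1 := unorm_seminorm R A mul mulP.
Let sub1 := unit_subspace R A.

Lemma unorm_one : N one <= 1.
Proof. by apply: le_trans (unorm_scalar R A mul mulP 1) _; rewrite absC1. Qed.

Lemma emb_lin (s t : R[i]) a b : s *: emb a + t *: emb b = emb (s *: a + t *: b).
Proof. by congr (_, _); rewrite /= !scaler0 addr0. Qed.

Lemma emb_sub a b : emb a - emb b = emb (a - b).
Proof. by congr (_, _); rewrite /= subr0. Qed.

Lemma D_emb_lin f s t a b : D f ->
  f (emb (s *: a + t *: b)) = s * f (emb a) + t * f (emb b).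
Proof. by move=> Df; rewrite -emb_lin D_add // !D_scale. Qed.

(** Here $z$ stands for $P(1)$: since $P$ fixes $A^{**}$, it maps $k1 + u$ to $kz + u$, with
    complement $k(1 - z)$. *)
Definition M_projection_of_one (z : (V1 -> R[i]) -> R[i]) : Prop :=
  A2 z /\ forall k u, A2 u ->
    bn (fun f => k * f one + u f) =
    Num.max (bn (fun f => k * z f + u f)) (bn (fun f => k * (f one - z f))).

Lemma M_ideal_projection : is_M_ideal (@inA R A mul) ->
  exists z, M_projection_of_one z.
Proof.
move=> [P [PA Pid [Pcongr PD] PZ Pmax]].
have B1 : B2 (@ev R (A1 mul) one) by exact: B2_ev.
exists (P (@ev R (A1 mul) one)); split; first exact: PA.
move=> k u Au; have [Bu _] := Au.
have Bk : B2 (fun f => k * f one).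
  have [_ _ BZ] := bidual_subspace R V1 _ N sub1 N1; exact: (BZ k _ B1).
have Bku : B2 (fun f => k * f one + u f).
  have [_ BD _] := bidual_subspace R V1 _ N sub1 N1; exact: (BD _ _ Bk Bu).
have PE f : D f -> P (fun f => k * f one + u f) f =
    k * P (@ev R (A1 mul) one) f + u f.
  move=> Df; rewrite [LHS](PD _ _ Bk Bu f Df).
  by rewrite /= [X in X + _](PZ k _ B1 f Df) (Pid _ Au f Df).
rewrite [LHS](Pmax _ Bku); congr Num.max; apply: bn_eq => f Df; first exact: PE.
by rewrite /= PE // mulN1r /=; ring.
Qed.

Variable z : (V1 -> R[i]) -> R[i].
Hypothesis zP : M_projection_of_one z.

Let Az : A2 z. Proof. by case: zP. Qed.
Let zmax k u : A2 u -> bn (fun f => k * f one + u f) =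
  Num.max (bn (fun f => k * z f + u f)) (bn (fun f => k * (f one - z f))).
Proof. by case: zP => _; apply. Qed.

Lemma bn_one_sub_z : bn (fun f => f one - z f) <= 1.
Proof.
have [B0 _ _] := bidual_subspace R V1 _ N sub1 N1.
have A0 : A2 (fun _ => 0) by split.
have -> : bn (fun f => f one - z f) = bn (fun f => 1 * (f one - z f)).
  by apply: bn_eq => f _; rewrite mul1r.
apply: le_trans (_ : bn (fun f => 1 * f one + 0) <= _).
  by rewrite (zmax 1 _ A0) le_max lexx orbT.
have -> : bn (fun f => 1 * f one + 0) = bn (@ev R (A1 mul) one).
  by apply: bn_eq => f _; rewrite mul1r addr0.
by apply: le_trans (bn_ev R A mul mulP one) unorm_one.
Qed.

Lemma bn_z : bn z <= 1.
Proof.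
have [B0 _ _] := bidual_subspace R V1 _ N sub1 N1.
have A0 : A2 (fun _ => 0) by split.
have -> : bn z = bn (fun f => 1 * z f + 0).
  by apply: bn_eq => f _; rewrite mul1r addr0.
apply: le_trans (_ : bn (fun f => 1 * f one + 0) <= _).
  by rewrite (zmax 1 _ A0) le_max lexx.
have -> : bn (fun f => 1 * f one + 0) = bn (@ev R (A1 mul) one).
  by apply: bn_eq => f _; rewrite mul1r addr0.
by apply: le_trans (bn_ev R A mul mulP one) unorm_one.
Qed.

(* The point mu of the segment [a, z] with |z - mu| <= 1 and |mu - a| <= eps
   is within 1 of the identity, because |1 - mu| = max (|z - mu|, |1 - z|). *)
Lemma bidual_intersection a (eps : R) : 0 < eps -> N (one - emb a) <= 1 + eps ->
  exists mu, [/\ A2 mu, bn (fun f => f one - mu f) <= 1 &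
    bn (fun f => f (emb a) - mu f) <= eps].
Proof.
move=> e0 Na.
have ep : 0 < 1 + eps by rewrite addr_gt0.
(* Weights with $s + t = 1$: as $\|z - a\| \le \|1 - a\| \le 1 + \varepsilon$, the point $\mu = ta +
   sz$ has $\|z - \mu\| = t\|z - a\| \le 1$ and $\|a - \mu\| = s\|z - a\| \le \varepsilon$. *)
pose s := eps / (1 + eps); pose t := (1 + eps)^-1.
have t0 : 0 <= t by rewrite invr_ge0 ltW.
have s0 : 0 <= s by rewrite mulr_ge0 // ltW.
have stC : s%:C%C = 1 - t%:C%C :> R[i].
  by rewrite -(rmorphB (real_complex R) 1 t) /s /t; congr (_%:C)%C; field; lra.
pose ea := @ev R (A1 mul) (jA mul a).
have Aea : A2 ea by exact: A2_ev.
have Azea : A2 (fun f => 1 * z f + (-1) * ea f) by exact: A2_lin.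
have nza : bn (fun f => 1 * z f + (-1) * ea f) <= 1 + eps.
  have AN : A2 (fun f => 0 * z f + (-1) * ea f) by exact: A2_lin.
  have := zmax 1 _ AN.
  have -> : bn (fun f => 1 * f one + (0 * z f + (-1) * ea f)) =
      bn (@ev R (A1 mul) (one - emb a)).
    apply: bn_eq => f Df; rewrite /ea /ev D_sub // -[jA mul a]/(emb a).
    by ring.
  have := bn_ev R A mul mulP (one - emb a) => h1 h2.
  have h3 : bn (fun f => 1 * z f + (0 * z f + -1 * ea f)) =
      bn (fun f => 1 * z f + (-1) * ea f).
    by apply: bn_eq => f _; ring.
  rewrite h3 in h2; apply: le_trans Na; apply: le_trans h1.
  by rewrite h2 le_max lexx.
pose mu f := t%:C%C * ea f + s%:C%C * z f.
have Amu : A2 mu by exact: A2_lin.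
exists mu; split => //.
  have AN : A2 (fun f => 0 * z f + (-1) * mu f) by exact: A2_lin.
  have := zmax 1 _ AN.
  have -> : bn (fun f => 1 * f one + (0 * z f + (-1) * mu f)) =
      bn (fun f => f one - mu f) by apply: bn_eq => f _; ring.
  move=> ->; rewrite ge_max; apply/andP; split; last first.
    have -> : bn (fun f => 1 * (f one - z f)) = bn (fun f => f one - z f).
      by apply: bn_eq => f _; rewrite mul1r.
    exact: bn_one_sub_z.
  have -> : bn (fun f => 1 * z f + (0 * z f + (-1) * mu f)) =
      bn (fun f => t%:C%C * (1 * z f + (-1) * ea f)).
    by apply: bn_eq => f _; rewrite /mu stC; ring.
  rewrite bn_scale //; last by case: Azea.
  by rewrite absC_nneg // /t ler_pdivrMl // mulr1.
have -> : bn (fun f => f (emb a) - mu f) =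
    bn (fun f => (- s%:C%C) * (1 * z f + (-1) * ea f)).
  by apply: bn_eq => f _; rewrite /mu stC /ea /ev -[jA mul a]/(emb a); ring.
rewrite bn_scale //; last by case: Azea.
by rewrite absCN absC_nneg // /s mulrAC ler_pdivrMr // ler_pM2l.
Qed.

(** If no such $b$ exists, the differences $b - c$, with $b$ nearly in the unit ball around 1 and
    $c$ nearly in the $\varepsilon$-ball around $a$, stay away from 0. A functional $F$ separating
    them from 0 is contradicted by a $b$ and a $c$ that both approximate $\mu$ at $F$. *)
Lemma approx_intersection a (eps d : R) : 0 < eps -> 0 < d ->
  N (one - emb a) <= 1 + eps ->
  exists b, N (one - emb b) <= 1 + d /\ N (emb (b - a)) <= eps + d.
Proof.
move=> e0 d0 Na; have [mu [Amu mu1 mua]] := bidual_intersection a eps e0 Na.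
pose d2 := d / 2; have d20 : 0 < d2 by rewrite /d2; lra.
apply: contrapT => far.
pose C (v : V1) := exists b c, [/\ N (one - emb b) <= 1 + d2,
  N (emb a - emb c) <= eps + d2 & v = emb (b - c)].
have NE x y : N (x + y) <= N x + N y := unormD R A mul mulP x y.
have C_conv : convex_in R V1 C.
  move=> s t _ _ s0 t0 st1 [b [c [Nb Nc ->]]] [b' [c' [Nb' Nc' ->]]].
  have stC : s%:C%C + t%:C%C = 1 :> R[i] by rewrite -rmorphD /= st1.
  have comb (x y : V1) (m : R) : N x <= m -> N y <= m ->
      N (s%:C%C *: x + t%:C%C *: y) <= m.
    move=> xm ym; apply: le_trans (NE _ _) _; rewrite !unormZ //.
    rewrite (absC_nneg _ _ (ltW s0)) (absC_nneg _ _ (ltW t0)).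
    by rewrite -[m]mul1r -st1 mulrDl; apply: lerD; rewrite ler_pM2l.
  exists (s%:C%C *: b + t%:C%C *: b'), (s%:C%C *: c + t%:C%C *: c'); split.
  - have -> : one - emb (s%:C%C *: b + t%:C%C *: b') =
        s%:C%C *: (one - emb b) + t%:C%C *: (one - emb b').
      by rewrite -emb_lin !scalerBr addrACA -opprD -scalerDl stC scale1r.
    exact: comb.
  - have -> : emb a - emb (s%:C%C *: c + t%:C%C *: c') =
        s%:C%C *: (emb a - emb c) + t%:C%C *: (emb a - emb c').
      by rewrite -emb_lin !scalerBr addrACA -opprD -scalerDl stC scale1r.
    exact: comb.
  - by rewrite emb_lin; congr (_, _); rewrite !scalerBr addrACA -opprD.
have Cd v : C v -> d2 <= N v.
  move=> [b [c [Nb Nc ->]]]; rewrite leNgt; apply/negP => bc; apply: far.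
  exists b; split; first by rewrite /d2 in Nb; lra.
  have -> : emb (b - a) = emb (b - c) - (emb a - emb c).
    by rewrite -!emb_sub opprB addrA subrK.
  have := NE (emb (b - c)) (- (emb a - emb c)); rewrite unormN //.
  by rewrite /d2 in bc Nc *; lra.
have [F [FD FZ FN Fd]] :=
  mazur_orlicz R V1 (fun _ => True) sub1 N C d2 N1 (fun _ _ => Logic.I) C_conv Cd.
have DF : D F by split => //; exists 1 => x _; rewrite mul1r; exact: FN.
have d40 : 0 < d2 / 2 by lra.
have half_le x : x + d2 / 2 <= x + d2 by lra.
(* Both approximations are within $d_2/2$ at $F$, so $|F(b) - F(c)| < d_2$. *)
have [b [Nb Fb]] := approx_in_A R A mul mulP unit mu one (fun _ => F) 1 _
  Amu ltr01 mu1 (fun _ => DF) d40.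
have [c [Nc Fc]] := approx_in_A R A mul mulP unit mu (emb a) (fun _ => F) eps _
  Amu e0 mua (fun _ => DF) d40.
have := Fd (emb (b - c)); rewrite -emb_sub (D_sub R A mul) //.
have -> : F (emb b) - F (emb c) = (F (emb b) - mu F) - (F (emb c) - mu F) by ring.
rewrite ReD => h.
have {}h := h (ex_intro _ b (ex_intro _ c (And3
  (le_trans Nb (half_le _)) (le_trans Nc (half_le _)) (emb_sub b c)))).
have {}Fb := Fb tt; have {}Fc := Fc tt; rewrite -absCN in Fc.
have := Re_le_absC _ (F (emb b) - mu F); have := Re_le_absC _ (- (F (emb c) - mu F)).
lra.
Qed.

End MApproximatelyUnital.

(** * Weak* density of ${\mathfrak F}_A$ and ${\mathfrak r}_A$ *)

Section Density.
Variables (R : realType) (A : completeNormedModType R[i]) (mul : A -> A -> A).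
Hypothesis mulP : is_banach_algebra mul.
Hypothesis A_unital : approx_unital mul.

Local Notation V1 := (A * R[i]^o)%type.
Local Notation N := (unorm mul).
Local Notation D := (@is_dual R (A1 mul)).
Local Notation dn := (@dnorm R (A1 mul)).
Local Notation B2 := (@is_dual R (dual (A1 mul))).
Local Notation bn := (@dnorm R (dual (A1 mul))).
Local Notation A2 := (@inAdd R A mul).
Local Notation one := ((0, 1) : V1).
Local Notation emb a := ((a, 0) : V1).
Let N1 := unorm_seminorm R A mul mulP.
Let sub1 := unit_subspace R A.

Lemma unorm_emb a : N (emb a) = nA a.
Proof. by case: A_unital => I [le [e h]]; exact: (unorm_embedE R A mul mulP I le e h). Qed.

Lemma FAE a : FA mul a <-> N (one - emb a) <= 1.
Proof.
rewrite /FA; suff -> : ((- a, 1) : A * R[i]) = one - emb a by [].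
by congr (_, _); rewrite /= ?sub0r ?subr0.
Qed.

Variable z : (V1 -> R[i]) -> R[i].
Hypothesis zP : M_projection_of_one R A mul z.

Lemma strict_intersection a (eps : R) : 0 < eps -> N (one - emb a) <= 1 + eps ->
  exists b, FA mul b /\ nA (b - a) <= 3 * eps.
Proof.
move=> e0 Na; pose r n := eps / 2 ^+ n.
have r0 n : 0 < r n by rewrite divr_gt0 // exprn_gt0.
have rS n : r n.+1 = r n / 2.
  by rewrite /r exprS invfM mulrCA mulrC.
(* Stated as an implication, with default value 0, so that choice gives a step function on all
   pairs. *)
have step (nx : nat * A) : exists b, N (one - emb nx.2) <= 1 + r nx.1 ->
    N (one - emb b) <= 1 + r nx.1.+1 /\ nA (b - nx.2) <= r nx.1 + r nx.1.+1.
  have [h|h] := pselect (N (one - emb nx.2) <= 1 + r nx.1); last by exists 0.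
  have [b [Nb ba]] :=
    approx_intersection R A mul mulP z zP _ _ _ (r0 nx.1) (r0 nx.1.+1) h.
  by exists b => _; rewrite -unorm_emb.
have [F FP] := choice step.
pose u := fix u n := if n is n.+1 then F (n, u n) else a.
have uN n : N (one - emb (u n)) <= 1 + r n.
  elim: n => [|n IHn]; first by rewrite /r expr0 divr1.
  by have [] := FP (n, u n) IHn.
have du n : nA (u n.+1 - u n) <= (3 / 2 * eps) / 2 ^+ n.
  have [_] := FP (n, u n) (uN n); rewrite /= rS => h; apply: le_trans h _.
  by rewrite -mulrA -/(r n); lra.
have [l hl] := geometric_limit R A u _ du.
exists l; split; last first.
  have := hl 0%N; rewrite /= expr0 divr1 -nAN opprB; lra.
apply/FAE; apply/ler_addgt0Pr => d d0.
(* The factor 4 collects $\|1 - u_n\| \le 1 + r_n$ and $\|u_n - l\| \le 3r_n$. *)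
have [n hn] := small_pow _ (4 * eps) _ d0.
have -> : one - emb l = (one - emb (u n)) + emb (u n - l).
  by rewrite -emb_sub addrA subrK.
apply: le_trans (unormD R A mul mulP _ _) _; rewrite unorm_emb.
have := hl n; have := uN n.
have -> : 2 * (3 / 2 * eps) / 2 ^+ n = 3 * r n by rewrite /r [RHS]mulrA; congr (_ * _); lra.
by rewrite -mulrA -/(r n) in hn; lra.
Qed.

(** [approx_in_A] gives $a$ with $\|1 - a\| \le 1 + 2r$ and error below $r$ at each $f_i$; moving
    $a$ into ${\mathfrak F}_A$ costs at most $3 \cdot 2r$ in norm. The slack $r$ in the hypothesis
    is what accretive elements require. *)
Lemma dense_FA (I : finType) (u : (V1 -> R[i]) -> R[i]) (f : I -> V1 -> R[i])
    (r : R) :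
  A2 u -> 0 < r -> bn (fun g => g one - u g) <= 1 + r -> (forall i, D (f i)) ->
  exists a, FA mul a /\
    forall i, absC (f i (emb a) - u (f i)) < (1 + 6 * \sum_i dn (f i)) * r.
Proof.
move=> Au r0 ur Df; have r1 : 0 < 1 + r by rewrite addr_gt0.
have [a [Na fa]] := approx_in_A R A mul mulP I u one f _ _ Au r1 ur Df r0.
have r2 : 0 < 2 * r by rewrite mulr_gt0.
have Na2 : N (one - emb a) <= 1 + 2 * r by lra.
have [b [Fb ba]] := strict_intersection a _ r2 Na2; exists b; split => // i.
have -> : f i (emb b) - u (f i) = (f i (emb a) - u (f i)) + f i (emb (b - a)).
  by rewrite -emb_sub (D_sub R A mul) //; ring.
apply: le_lt_trans (absCD _ _ _) _; have := fa i.
have := D_le R A mul mulP _ (emb (b - a)) (Df i); rewrite unorm_emb.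
have D0 j : 0 <= dn (f j) by exact: (D_ge0 R A mul mulP).
have : dn (f i) * nA (b - a) <= (\sum_i dn (f i)) * (3 * (2 * r)).
  apply: ler_pM => //; first exact: nA_ge0.
  by rewrite (bigD1 i) //= lerDl sumr_ge0.
by move: (\sum_i _) => K; rewrite mulrDl mul1r; lra.
Qed.

Lemma FA_dense : @wstar_dense R (A1 mul)
  (fun x => exists a, x = jA mul a /\ FA mul a) (@FAdd R A mul).
Proof.
split=> [_ [a [-> Fa]]|u [Au nu] n f Df eps e0].
  split; first exact: A2_ev.
  move/FAE: Fa; apply: le_trans; apply: le_trans (bn_ev R A mul mulP _).
  rewrite le_eqVlt; apply/orP; left; apply/eqP; apply: bn_eq => g Dg.
  by rewrite /= /one1dd /ev (D_sub R A mul) // mulN1r.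
pose K := \sum_i dn (f i).
have K0 : 0 <= K by apply: sumr_ge0 => i _; exact: (D_ge0 R A mul mulP _ (Df i)).
have r0 : 0 < eps / (1 + 6 * K) by rewrite divr_gt0 //; lra.
have ur : bn (fun g => g one - u g) <= 1 + eps / (1 + 6 * K).
  apply: le_trans (_ : 1 <= _); last by rewrite lerDl ltW.
  apply: le_trans nu; rewrite le_eqVlt; apply/orP; left; apply/eqP.
  by apply: bn_eq => g Dg; rewrite /= mulN1r.
have [a [Fa fa]] := dense_FA 'I_n u f _ Au r0 ur Df.
exists (jA mul a); split; first by exists a.
move=> i; apply: lt_le_trans (fa i) _; rewrite -/K.
by rewrite mulrC divfK // gt_eqF //; lra.
Qed.

(** A state satisfies $\mathrm{Re}\,\varphi(1 - a) \le \|1 - a\| \le 1$. *)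
Lemma FA_rA a : FA mul a -> rA mul a.
Proof.
move=> /FAE Na phi [Dphi nphi phi1].
have := D_le R A mul mulP phi (one - emb a) Dphi; rewrite [dn phi]nphi mul1r.
have := Re_le_absC _ (phi (one - emb a)).
by rewrite (D_sub R A mul) // ReD ReN -[phi one]/(phi (one1 mul)) phi1 /jA /=; lra.
Qed.

Let V2 := ((V1 -> R[i]^o) -> R[i]^o).
Let sub2 : subspace R V2 B2 := bidual_subspace R V1 _ N sub1 N1.
Let sem2 : seminorm R V2 B2 bn := bidual_seminorm R V1 _ N sub1 N1.

(** The difference of the two representatives has norm 0, so a bounded functional does not see
    it. *)
Lemma tridual_eq (Phi : V2 -> R[i]) (u v : V2) :
  @is_dual R (dual (dual (A1 mul))) Phi -> B2 u -> B2 v ->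
  (forall f, D f -> u f = v f) -> Phi u = Phi v.
Proof.
move=> DPhi Bu Bv uv; apply/eqP; rewrite -subr_eq0; apply/eqP.
have [B0 BD BZ] := sub2.
have Buv : B2 (u - v) by apply: BD => //; rewrite -scaleN1r; exact: BZ.
have := dual_le R V2 B2 bn sub2 sem2 Phi _ DPhi Buv.
have -> : bn (u - v) = 0.
  have -> : bn (u - v) = bn (0 : V2).
    by apply: bn_eq => f Df; rewrite /= -[LHS]/(u f - v f) uv // subrr.
  by have [_ nZ] := sem2; rewrite -(scale0r 0) nZ // absC0 mul0r.
rewrite mulr0 (is_dualB R V2 B2 bn sub2) // => h.
by apply: absC_eq0; apply/eqP; rewrite eq_le h absC_ge0.
Qed.

Lemma eq1_of_Re (w : R[i]) : absC w <= 1 -> 1 <= complex.Re w -> w = 1.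
Proof.
case: w => a b /=; rewrite /absC normc_def /= => h a1.
have h2 : a ^+ 2 + b ^+ 2 <= 1.
  have s0 : 0 <= a ^+ 2 + b ^+ 2 by rewrite addr_ge0 ?sqr_ge0.
  by rewrite -(sqr_sqrtr s0) expr_le1 // sqrtr_ge0.
have a21 : 1 <= a ^+ 2 by rewrite expr_ge1 //; lra.
have b0 : b = 0.
  by apply/eqP; rewrite -sqrf_eq0 eq_le sqr_ge0 andbT; lra.
have -> : a = 1.
  apply/eqP; rewrite eq_le a1 andbT -(expr_le1 (n := 2)) //; last by lra.
  by have := sqr_ge0 b; lra.
by rewrite b0.
Qed.

(* The numerical range of u is controlled by |1 - t u| as t -> 0+: otherwise a
   functional separating the ray {1 - t (u + e)} from the open unit ball is a
   state whose real part at u is at most - e. *)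
Lemma accretive_norm (u : V2) (e : R) : @rA1dd R A mul u -> 0 < e ->
  exists t : R, 0 < t /\ bn (fun g => g one - t%:C%C * u g) <= 1 + t * e.
Proof.
move=> [Bu pos] e0.
have B1 : B2 (@ev R (A1 mul) one) by exact: B2_ev.
have n1 : bn (@ev R (A1 mul) one) <= 1.
  by apply: le_trans (bn_ev R A mul mulP one) (unorm_one R A mul mulP).
have Blin k l : B2 (fun g => k * g one + l * u g) by exact: (B2_lin R A mul mulP).
have [t [t0 ht]] : exists t : R, 0 <= t /\
    bn (fun g => g one - t%:C%C * (u g + e%:C%C * g one)) < 1.
  apply: contrapT => far.
  pose C (v : V2) := exists t : R, 0 <= t /\
    v = (fun g => g one - t%:C%C * (u g + e%:C%C * g one)).
  have CB v : C v -> B2 v.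
    move=> [t [_ ->]]; have := Blin (1 - t%:C%C * e%:C%C) (- t%:C%C).
    by congr B2; apply/funext => g; ring.
  have C_conv : convex_in R V2 C.
    move=> s t _ _ s0 t0 st1 [x [x0 ->]] [y [y0 ->]].
    exists (s * x + t * y); split.
      by rewrite addr_ge0 // mulr_ge0 // ltW.
    apply/funext => g; rewrite rmorphD /= !rmorphM /=.
    rewrite -[LHS]/(s%:C%C * (g one - x%:C%C * (u g + e%:C%C * g one))
      + t%:C%C * (g one - y%:C%C * (u g + e%:C%C * g one))).
    have -> : s%:C%C = 1 - t%:C%C :> R[i].
      by rewrite -(rmorphB (real_complex R) 1 t) -st1 addrK.
    by ring.
  have Cb v : C v -> 1 <= bn v.
    by move=> [t [t0 ->]]; rewrite leNgt; apply/negP => h; apply: far; exists t.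
  have [F [FD FZ FN F1]] := mazur_orlicz R V2 B2 sub2 bn C 1 sem2 CB C_conv Cb.
  have DF : @is_dual R (dual (dual (A1 mul))) F.
    by split; [exact: FD|exact: FZ|exists 1 => v Bv; rewrite mul1r; exact: FN].
  have FE (t : R) : 0 <= t -> 1 <= complex.Re (F (@ev R (A1 mul) one) -
      t%:C%C * (F u + e%:C%C * F (@ev R (A1 mul) one))).
    move=> t0; have [_ BD BZ] := sub2; set E := @ev R (A1 mul) one in B1 *.
    have := F1 _ (ex_intro _ t (conj t0 erefl)).
    have -> : (fun g => g one - t%:C%C * (u g + e%:C%C * g one)) =
        (E : V2) + (- t%:C%C) *: ((u : V2) + e%:C%C *: (E : V2)).
      by apply/funext => g; rewrite -mulNr.
    rewrite FD //; last by apply/BZ/BD => //; exact: BZ.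
    rewrite FZ; last by apply: BD => //; exact: BZ.
    by rewrite FD //; [rewrite FZ // mulNr|exact: BZ].
  (* The point $t = 0$ of the ray gives $\mathrm{Re}\,F(1) \ge 1$, while $|F(1)| \le 1$. *)
  have Fone : F (@ev R (A1 mul) one) = 1.
    apply: eq1_of_Re; first exact: le_trans (FN _ B1) n1.
    by have := FE 0 (lexx _); rewrite mul0r subr0.
  have state : is_state (@one1dd R A mul) F.
    split=> //; apply/eqP; rewrite eq_le; apply/andP; split.
      apply: (dnorm_ub R V2 B2 bn sub2 sem2) => v Bv nv.
      exact: le_trans (FN _ Bv) nv.
    have := dual_le R V2 B2 bn sub2 sem2 F _ DF B1; rewrite Fone absC1 => h.
    apply: le_trans h _; rewrite -[leRHS]mulr1 ler_wpM2l //.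
    exact: (dnorm_ge0 R V2 B2 bn sub2 sem2).
  have := pos F state; have := FE 1 ler01.
  rewrite Fone mul1r mulr1 opprD !ReD !ReN /=; lra.
have [t00|tn] := eqVneq t 0; last first.
  have tp : 0 < t by rewrite lt_def tn.
  exists t; split => //.
  have -> : bn (fun g => g one - t%:C%C * u g) =
      bn (fun g => (g one - t%:C%C * (u g + e%:C%C * g one)) +
        (t * e)%:C%C * g one).
    by apply: bn_eq => g _; rewrite rmorphM /=; ring.
  apply: le_trans (bn_add R A mul mulP _ _ _ _) _.
  - have := Blin (1 - t%:C%C * e%:C%C) (- t%:C%C).
    by congr B2; apply/funext => g; ring.
  - by have [_ _ BZ] := sub2; exact: (BZ _ _ B1).
  have te0 : 0 <= t * e by rewrite mulr_ge0 // ltW.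
  rewrite (bn_scale R A mul mulP _ _ B1) (absC_nneg _ _ te0).
  apply: lerD; first exact: ltW.
  by rewrite -[leRHS]mulr1 ler_wpM2l.
(* In the degenerate case $t = 0$ one has $\|1\| < 1$; the value of $s$ below then gives $\|1\| +
   s\|u\| = 1 - s$. *)
have nE : bn (@ev R (A1 mul) one) < 1.
  apply: le_lt_trans ht; rewrite le_eqVlt; apply/orP; left; apply/eqP.
  by apply: bn_eq => g _; rewrite t00 mul0r subr0.
have u0 : 0 <= bn u by exact: (seminorm_ge0 R V2 B2 sub2).
pose s := (1 - bn (@ev R (A1 mul) one)) / (1 + bn u).
have sp : 0 < s by rewrite divr_gt0 //; lra.
exists s; split => //.
have -> : bn (fun g => g one - s%:C%C * u g) =
    bn (fun g => @ev R (A1 mul) one g + (- s%:C%C) * u g).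
  by apply: bn_eq => g _; rewrite mulNr.
apply: le_trans (bn_add R A mul mulP _ _ B1 _) _.
  by have [_ _ BZ] := sub2; exact: (BZ _ _ Bu).
rewrite (bn_scale R A mul mulP _ _ Bu) absCN (absC_nneg _ _ (ltW sp)).
have : s * (1 + bn u) = 1 - bn (@ev R (A1 mul) one).
  by rewrite divfK // gt_eqF //; lra.
have : 0 < s * e by rewrite mulr_gt0.
by rewrite mulrDr; lra.
Qed.

Lemma rA_dense : @wstar_dense R (A1 mul)
  (fun x => exists a, x = jA mul a /\ rA mul a) (@rAdd R A mul).
Proof.
split=> [_ [a [-> ra]]|u [Au ru] n f Df eps e0].
  split; first exact: A2_ev.
  split; first exact: B2_ev.
  move=> Phi [DPhi nPhi Phi1]; have [PD PZ _] := DPhi.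
  have Bev x : B2 (@ev R (A1 mul) x) by exact: B2_ev.
  have [_ BD BZ] := sub2.
  (* A state of the bidual restricts along [ev] to a state of $A^1$. Additivity and homogeneity pass
     through [tridual_eq], since [ev] is compared with sums and multiples only on bounded
     functionals. *)
  pose phi (x : V1) := Phi (@ev R (A1 mul) x).
  have phi_le x : absC (phi x) <= N x.
    have := dual_le R V2 B2 bn sub2 sem2 Phi _ DPhi (Bev x).
    rewrite [@dnorm _ _ Phi]nPhi mul1r => h; apply: le_trans h _.
    exact: (bn_ev R A mul mulP).
  have Dphi : D phi.
    split=> [x y _ _|k x _|]; last by exists 1 => x _; rewrite mul1r; exact: phi_le.
    - rewrite -[RHS](PD _ _ (Bev x) (Bev y)).
      apply: (tridual_eq Phi _ _ DPhi (Bev (x + y)) (BD _ _ (Bev x) (Bev y))).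
      by move=> g Dg; rewrite /ev [LHS](D_add R A mul).
    - rewrite -[RHS](PZ _ _ (Bev x)).
      apply: (tridual_eq Phi _ _ DPhi (Bev (k *: x)) (BZ _ _ (Bev x))).
      by move=> g Dg; rewrite /ev [LHS](D_scale R A mul).
  apply: (ra phi); split => //; apply/eqP; rewrite eq_le; apply/andP; split.
    by apply: (dnorm_ub R V1 _ N sub1 N1) => x _ nx; apply: le_trans (phi_le x) nx.
  have := D_le R A mul mulP phi one Dphi.
  rewrite [phi one]Phi1 absC1 => h; apply: le_trans h _.
  rewrite -[leRHS]mulr1 ler_wpM2l ?(unorm_one R A mul mulP) //.
  exact: (D_ge0 R A mul mulP).
pose K := \sum_i dn (f i).
have K0 : 0 <= K by apply: sumr_ge0 => i _; exact: (D_ge0 R A mul mulP _ (Df i)).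
have r0 : 0 < eps / (1 + 6 * K) by rewrite divr_gt0 //; lra.
(* [dense_FA] for $tu$ with slack $tr$ has error $(1 + 6K)tr = t\varepsilon$, which becomes
   $\varepsilon$ after division by $t$. *)
have [t [t0 ut]] := accretive_norm u _ ru r0.
have Atu : A2 (fun g => t%:C%C * u g).
  have := A2_lin R A mul mulP t%:C%C 0 _ _ Au Au.
  by congr (inAdd _); apply/funext => g; rewrite mul0r addr0.
have tr0 := mulr_gt0 t0 r0.
have [a [Fa fa]] := dense_FA 'I_n _ f _ Atu tr0 ut Df.
have tn : t%:C%C != 0 :> R[i] by apply/eqP => -[h]; rewrite h ltxx in t0.
have it0 : 0 < t^-1 by rewrite invr_gt0.
exists (emb (t^-1%:C%C *: a)); split.
  exists (t^-1%:C%C *: a); split => // phi Sphi; have [Dphi _ _] := Sphi.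
  have := FA_rA _ Fa phi Sphi.
  have -> : jA mul (t^-1%:C%C *: a) = t^-1%:C%C *: (emb a : V1).
    by congr (_, _); rewrite /= scaler0.
  by rewrite (D_scale R A mul) // ReZ => h; rewrite mulr_ge0 // ltW.
move=> i; have -> : f i (emb (t^-1%:C%C *: a)) = t^-1%:C%C * f i (emb a).
  rewrite -(D_scale R A mul) //; last exact: Df.
  by congr (f i (_, _)); rewrite /= scaler0.
have -> : t^-1%:C%C * f i (emb a) - u (f i) =
    t^-1%:C%C * (f i (emb a) - t%:C%C * u (f i)).
  by rewrite mulrBr mulrA -rmorphM /= mulVf ?gt_eqF // mul1r.
rewrite absCM (absC_nneg _ _ (ltW it0)) ltr_pdivrMl //.
apply: lt_le_trans (fa i) _; rewrite -/K mulrCA [(1 + 6 * K) * _]mulrC divfK //.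
by rewrite gt_eqF //; lra.
Qed.

End Density.

(** * A contractive approximate identity in $\frac12{\mathfrak F}_A$ *)

Section ApproximateIdentity.
Variables (R : realType) (A : completeNormedModType R[i]) (mul : A -> A -> A).
Hypothesis mulP : is_banach_algebra mul.
Variables (I : Type) (le : I -> I -> Prop) (e : I -> A).
Hypothesis e_cai : is_cai mul le e.

Local Notation V1 := (A * R[i]^o)%type.
Local Notation N := (unorm mul).
Local Notation D := (@is_dual R (A1 mul)).
Local Notation dn := (@dnorm R (A1 mul)).
Local Notation B2 := (@is_dual R (dual (A1 mul))).
Local Notation bn := (@dnorm R (dual (A1 mul))).
Local Notation A2 := (@inAdd R A mul).
Local Notation one := ((0, 1) : V1).
Local Notation emb a := ((a, 0) : V1).
Let N1 := unorm_seminorm R A mul mulP.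
Let sub1 := unit_subspace R A.
Let A_unital : approx_unital mul. Proof. by exists I, le, e. Qed.

Variable z : (V1 -> R[i]) -> R[i].
Hypothesis zP : M_projection_of_one R A mul z.

Lemma cai_eventually_seq (s : seq A) (d : R) : 0 < d -> exists t0, forall t,
  le t0 t -> forall b, b \in s ->
    nA (mul b (e t) - b) < d /\ nA (mul (e t) b - b) < d.
Proof.
move=> d0; have [[[i0 _] _ tr dir] _ conv] := e_cai.
elim: s => [|a s [t0 h0]]; first by exists i0.
have [/(_ d d0)[t1 h1] /(_ d d0)[t2 h2]] := conv a.
have [u [t1u t2u]] := dir t1 t2; have [v [t0v uv]] := dir t0 u.
exists v => t vt b; rewrite inE => /orP[/eqP->|bs]; last first.
  by apply: h0 => //; exact: (tr _ _ _ t0v vt).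
split; first by apply: h2; exact: (tr _ _ _ (tr _ _ _ t2u uv) vt).
by apply: h1; exact: (tr _ _ _ (tr _ _ _ t1u uv) vt).
Qed.

(* Let g agree with U on A and g 1 = lim U (e t); then g has the norm of the
   restriction of U to A. As |k (1 - z) + b| <= 1 for all b in the unit ball of A
   and unimodular k, a nonzero value of 1 - z at g would make g too small on A. *)
Lemma z_limit (U : V1 -> R[i]) (c : R[i]) : D U ->
  (forall d : R, 0 < d -> exists t0, forall t, le t0 t ->
     absC (U (emb (e t)) - c) < d) ->
  z U = c.
Proof.
move=> DU Uc; have [Bz z0] : A2 z by case: zP.
have [[_ _ _ dir] e1 conv] := e_cai.
pose g (y : V1) : R[i] := U (emb y.1) + y.2 * c.
have Uemb b : absC (U (emb b)) <= dn U * nA b.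
  by rewrite -(unorm_emb R A mul mulP A_unital); exact: D_le.
have gD x y : g (x + y) = g x + g y.
  rewrite /g /= mulrDl addrACA -(D_add R A mul) //; congr (U _ + _).
  by congr (_, _); rewrite /= addr0.
have gZ k y : g (k *: y) = k * g y.
  rewrite /g /= mulrDr mulrA -(D_scale R A mul) //; congr (U _ + _).
  by congr (_, _); rewrite /= scaler0.
(* $g(y)$ is the limit of $U(y e_t)$ and $\|y e_t\| \le \|y\|$, so bounds for $U$ on $A$ pass to $g$
   on $A^1$. *)
have g_le (m : R) : (forall b, absC (U (emb b)) <= m * nA b) ->
    forall y, absC (g y) <= m * N y.
  move=> Um y; apply/ler_addgt0Pr => d d0.
  pose K := dn U + absC y.2.
  have K0 : 0 <= K by rewrite addr_ge0 ?absC_ge0 // (D_ge0 R A mul mulP).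
  pose d' := d / (1 + K).
  have d'0 : 0 < d' by rewrite divr_gt0 // ltr_pwDl.
  have dE : d' + K * d' = d by rewrite /d'; field; lra.
  have [t1 ht1] := Uc _ d'0; have [_ /(_ _ d'0)[t2 ht2]] := conv y.1.
  have [t [t1t t2t]] := dir t1 t2.
  have := ht1 t t1t; have := ht2 t t2t => h2 h1.
  have -> : g y = U (emb (lact R A mul y (e t)))
      + (- U (emb (mul y.1 (e t) - y.1)) - y.2 * (U (emb (e t)) - c)).
    have := D_emb_lin R A mul U 1 y.2 (mul y.1 (e t)) (e t) DU.
    rewrite scale1r mul1r /g /lact => ->.
    by rewrite -(emb_sub R A) (D_sub R A mul) //; ring.
  apply: le_trans (absCD _ _ _) _; apply: lerD.
    (* A negative [m] forces [nA] to vanish identically, and then [unorm] vanishes too. *)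
    apply: le_trans (Um _) _; have [m0|m0] := leP 0 m.
      rewrite ler_wpM2l //; exact: unorm_ge.
    have nAz (x : A) : nA x = 0.
      apply/eqP; rewrite eq_le nA_ge0 andbT -(ler_nM2l m0) mulr0.
      by apply: le_trans (Um x); exact: absC_ge0.
    have -> : N y = 0.
      apply/eqP; rewrite eq_le unorm_ge0 // andbT.
      by apply: (unorm_ub R A mul) => x _; rewrite nAz.
    by rewrite nAz.
  apply: le_trans (absCD _ _ _) _; rewrite !absCN absCM.
  have := Uemb (mul y.1 (e t) - y.1).
  have : dn U * nA (mul y.1 (e t) - y.1) <= dn U * d'.
    by rewrite ler_wpM2l ?(D_ge0 R A mul mulP) // ltW.
  have : absC y.2 * absC (U (emb (e t)) - c) <= absC y.2 * d'.
    by rewrite ler_wpM2l ?absC_ge0 // ltW.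
  by rewrite /K in dE; rewrite mulrDl in dE; lra.
have Dg : D g.
  split; [by move=> x y _ _; exact: gD|by move=> k x _; exact: gZ|].
  by exists (dn U) => y _; exact: g_le.
have g1 : g one = c.
  by rewrite /g /= mul1r (is_dual0 R V1 _ N sub1 _ DU) add0r.
have gemb b : g (emb b) = U (emb b) by rewrite /g /= mul0r addr0.
pose d := g one - z g.
have d_le : absC d <= dn g.
  have B1 : B2 (fun f => f one - z f).
    have := B2_lin R A mul mulP 1 (-1) _ _ (B2_ev R A mul mulP one) Bz.
    by congr B2; apply/funext => f; rewrite mul1r mulN1r.
  apply: le_trans (bidual_le R V1 _ N sub1 N1 _ g B1 Dg) _.
  by rewrite -[leRHS]mul1r ler_wpM2r ?(bn_one_sub_z R A mul mulP z zP) //;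
    exact: (D_ge0 R A mul mulP).
(* With $kd = |d|$, $lU(b) = |U(b)|$ and $s = \|b\|$, the maximum formula bounds the norm of $sk(1 -
   z) + lb$ by $\|b\|$; its value at $g$ is $\|b\||d| + |U(b)|$. *)
have Um b : absC (U (emb b)) <= (dn g - absC d) * nA b.
  have [k [k1 kd]] := absC_phase _ d; have [l [l1 lU]] := absC_phase _ (U (emb b)).
  pose s := (nA b)%:C%C; pose ev_lb := @ev R (A1 mul) (jA mul (l *: b)).
  have Au : A2 (fun f => (- (s * k)) * z f + 1 * ev_lb f).
    exact: (A2_lin R A mul mulP _ _ _ _ zP.1 (A2_ev R A mul mulP _)).
  have [_ /(_ (s * k) _ Au)] := zP.
  have -> : bn (fun f => s * k * z f + (- (s * k) * z f + 1 * ev_lb f)) = bn ev_lb.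
    by apply: bn_eq => f _; ring.
  have nlb : bn ev_lb <= nA b.
    apply: le_trans (bn_ev R A mul mulP _) _.
    by rewrite [N _](unorm_emb R A mul mulP A_unital) nAZ l1 mul1r.
  have nk : bn (fun f => s * k * (f one - z f)) <= nA b.
    rewrite (bn_scale R A mul mulP); last first.
      have := B2_lin R A mul mulP 1 (-1) _ _ (B2_ev R A mul mulP one) Bz.
      by congr B2; apply/funext => f; rewrite mul1r mulN1r.
    rewrite absCM k1 mulr1 absC_nneg ?nA_ge0 // -[leRHS]mulr1.
    by rewrite ler_wpM2l ?nA_ge0 // (bn_one_sub_z R A mul mulP z zP).
  move=> hmax.
  have hw : bn (fun f => s * k * f one + (- (s * k) * z f + 1 * ev_lb f)) <= nA b.
    by rewrite hmax ge_max nlb nk.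
  have Bw : B2 (fun f => s * k * f one + (- (s * k) * z f + 1 * ev_lb f)).
    have := B2_lin R A mul mulP (s * k) 1 _ _ (B2_ev R A mul mulP one) Au.1.
    by congr B2; apply/funext => f; rewrite [X in _ + X]mul1r.
  have := bidual_le R V1 _ N sub1 N1 _ g Bw Dg.
  have -> : s * k * g one + (- (s * k) * z g + 1 * ev_lb g) =
      (nA b * absC d + absC (U (emb b)))%:C%C.
    rewrite rmorphD rmorphM /= -kd -lU /ev_lb /ev -[jA mul _]/(emb (l *: b)) gemb.
    have -> : U (emb (l *: b)) = l * U (emb b).
      rewrite -(D_scale R A mul) //; congr U.
      by congr (_, _); rewrite /= scaler0.
    by rewrite /d /s; ring.
  rewrite absC_nneg; last by rewrite addr_ge0 ?mulr_ge0 ?absC_ge0 ?nA_ge0.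
  have : bn (fun f => s * k * f one + (- (s * k) * z f + 1 * ev_lb f)) * dn g
      <= nA b * dn g by rewrite ler_wpM2r ?(D_ge0 R A mul mulP).
  by lra.
(* Transferred to $A^1$, the bound reads $\|g\| \le \|g\| - |d|$, so $d = 0$. *)
have gm := g_le _ Um.
have : dn g <= dn g - absC d.
  apply: (dnorm_ub R V1 _ N sub1 N1) => x _ nx; apply: le_trans (gm x) _.
  by rewrite -[leRHS]mulr1 ler_wpM2l // subr_ge0.
move=> hd; have d0 : d = 0.
  by apply: absC_eq0; have := absC_ge0 _ d; lra.
(* $g - U$ vanishes on $A$ and $z$ lies in $A^{\perp\perp}$. *)
have zgU : z g = z U.
  have [_ DD DZ] := dual_subspace R V1 _ N sub1 N1.
  have [zD zZ _] := Bz.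
  have DU' : D (fun x => -1 * U x) by exact: (DZ (-1) U DU).
  have : z (fun x => g x + -1 * U x) = 0.
    apply: z0; split; first exact: (DD g _ Dg DU').
    by move=> x [a ->]; rewrite [g _]gemb mulN1r subrr.
  rewrite [LHS](zD _ _ Dg DU') [X in _ + X](zZ (-1) U DU) mulN1r.
  by move=> /eqP; rewrite subr_eq0 => /eqP.
by move: d0; rewrite /d g1 zgU => /eqP; rewrite subr_eq0 => /eqP.
Qed.

(** The maximum formula at $1 - 2z$, whose projection is $-z$ with complement $1 - z$. *)
Lemma FAdd_double_z : bn (fun f => f one - 2 * z f) <= 1.
Proof.
have [Az /(_ 1)] := zP.
have AN : A2 (fun f => (-2) * z f + 0 * z f) by exact: A2_lin.
move=> /(_ _ AN) h.
have -> : bn (fun f => f one - 2 * z f) =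
    bn (fun f => 1 * f one + (-2 * z f + 0 * z f)) by apply: bn_eq => f _; ring.
rewrite h ge_max; apply/andP; split.
  have -> : bn (fun f => 1 * z f + (-2 * z f + 0 * z f)) = bn (fun f => (-1) * z f).
    by apply: bn_eq => f _; ring.
  rewrite (bn_scale R A mul mulP) ?absCN ?absC1 ?mul1r; last by case: Az.
  exact: (bn_z R A mul mulP z zP).
have -> : bn (fun f => 1 * (f one - z f)) = bn (fun f => f one - z f).
  by apply: bn_eq => f _; rewrite mul1r.
exact: (bn_one_sub_z R A mul mulP z zP).
Qed.

(** Otherwise the convex set of tuples $(xb - b, bx - b)_b$, with $x$ in $\frac12{\mathfrak F}_A$,
    is separated from 0 by some $F$. The induced functional $U$ on $A^1$ converges along $(e_t)$ to
    $F$ at the tuple of all $(b, b)$, so $z(U)$ equals this value, and the density of ${\mathfrak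
    F}_A$ near $2z$ contradicts the separation. *)
Lemma half_FA_unit (s : seq A) (d : R) : 0 < d -> exists x, FA mul (2 *: x) /\
  forall b, b \in s -> nA (mul x b - b) < d /\ nA (mul b x - b) < d.
Proof.
move=> d0; apply: contrapT => far.
pose n := size s; pose b (i : 'I_n) := nth 0 s i.
pose W := {ffun 'I_n -> A * A}.
pose q (v : W) := \sum_i (nA (v i).1 + nA (v i).2).
have q_sem : seminorm R W (fun _ => True) q.
  split => [x y _ _|k x _]; rewrite /q.
    rewrite -big_split /=; apply: ler_sum => i _; rewrite ffunE /= addrACA.
    by apply: lerD; exact: nAD.
  rewrite mulr_sumr; apply: eq_bigr => i _; rewrite ffunE /= !nAZ mulrDr //.
pose T (y : V1) : W := [ffun i => (lact R A mul y (b i), ract R A mul (b i) y)].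
pose T0 : W := [ffun i => (b i, b i)].
have TD x y : T (x + y) = T x + T y.
  apply/ffunP => i; rewrite !ffunE; congr (_, _); first exact: lactD.
  by rewrite /ract /= mulADr // scalerDl addrACA.
have TZ k x : T (k *: x) = k *: T x.
  apply/ffunP => i; rewrite !ffunE; congr (_, _); first exact: lactZ.
  by rewrite /ract /= mulAZr // scalerDr scalerA.
pose C (v : W) := exists x, FA mul (2 *: x) /\ v = T (emb x) - T0.
have TE x i : (T (emb x) - T0) i = (mul x (b i) - b i, mul (b i) x - b i).
  by rewrite !ffunE; congr (_, _); rewrite /lact /ract /= scale0r addr0.
have C_conv : convex_in R W C.
  move=> r t _ _ r0 t0 rt1 [x [Fx ->]] [y [Fy ->]].
  have rtC : r%:C%C + t%:C%C = 1 :> R[i] by rewrite -rmorphD /= rt1.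
  exists (r%:C%C *: x + t%:C%C *: y); split.
    move/FAE: Fx => Fx; move/FAE: Fy => Fy; apply/FAE.
    have -> : one - emb (2 *: (r%:C%C *: x + t%:C%C *: y)) =
        r%:C%C *: (one - emb (2 *: x)) + t%:C%C *: (one - emb (2 *: y)).
      rewrite !scalerBr addrACA -opprD -scalerDl rtC scale1r emb_lin.
      by congr (_ - (_, _)); rewrite scalerDr !scalerA ![_%:C%C * 2]mulrC.
    apply: le_trans (unormD R A mul mulP _ _) _; rewrite !(unormZ R A mul mulP).
    rewrite (absC_nneg _ _ (ltW r0)) (absC_nneg _ _ (ltW t0)).
    by rewrite -rt1 -[X in _ <= X + _]mulr1 -[X in _ <= _ + X]mulr1;
      apply: lerD; rewrite ler_pM2l.
  rewrite -emb_lin TD !TZ !scalerBr addrACA -opprD -scalerDl rtC scale1r //.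
have Cd v : C v -> d <= q v.
  move=> [x [Fx ->]]; rewrite leNgt; apply/negP => qd; apply: far.
  exists x; split => // a /(nthP 0)[i ni <-].
  have := qd; rewrite /q (bigD1 (Ordinal ni)) //= TE /=.
  set rest := (X in _ + X); have : 0 <= rest.
    by apply: sumr_ge0 => j _; rewrite addr_ge0 ?nA_ge0.
  rewrite /b /=; have := nA_ge0 _ _ (mul x (nth 0 s i) - nth 0 s i).
  have := nA_ge0 _ _ (mul (nth 0 s i) x - nth 0 s i).
  by move: rest => rest *; split; lra.
have sW : subspace R W (fun _ => True) by [].
have [F [FD FZ FN Fd]] :=
  mazur_orlicz R W (fun _ => True) sW q C d q_sem (fun _ _ => Logic.I) C_conv Cd.
pose U (y : V1) := F (T y).
have DU : D U.
  split => [x y _ _|k x _|]; rewrite /U.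
  - by rewrite -FD // -TD.
  - by rewrite -FZ // -TZ.
  - exists (\sum_i 2 * nA (b i)) => y _; apply: le_trans (FN _ Logic.I) _.
    rewrite mulr_suml; apply: ler_sum => i _; rewrite ffunE /=.
    have := lact_le R A mul mulP y (b i).
    have := ract_le R A mul mulP I le e e_cai (b i) y.
    rewrite -[N y]/(nrm (y : car (A1 mul))); move: (nrm _) => m; nra.
have FB x : F (T x) - F T0 = F (T x - T0).
  by rewrite -[- T0]scaleN1r FD // FZ // mulN1r.
have Uc (r : R) : 0 < r -> exists t0, forall t, le t0 t ->
    absC (U (emb (e t)) - F T0) < r.
  (* Each of the $2n$ components will be below $r'$; the extra 1 in the denominator keeps $2nr' <
     r$, also for $n = 0$. *)
  move=> r0; pose r' := r / (1 + 2 * n%:R).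
  have n0 : 0 <= n%:R :> R by [].
  have r'0 : 0 < r' by rewrite divr_gt0 //; lra.
  have rE : r' + 2 * n%:R * r' = r by rewrite /r'; field; lra.
  have [t0 ht0] := cai_eventually_seq s _ r'0; exists t0 => t t0t.
  rewrite FB; apply: le_lt_trans (FN _ Logic.I) _.
  apply: le_lt_trans (_ : \sum_(i < n) (2 * r') < _).
    apply: ler_sum => i _; rewrite TE /=.
    have bi : b i \in s by exact: mem_nth.
    by have [] := ht0 t t0t _ bi; lra.
  by rewrite sumr_const card_ord -mulr_natr; lra.
have zU := z_limit U (F T0) DU Uc.
pose K := \sum_(i < 1) dn U.
have K0 : 0 <= K by apply: sumr_ge0 => i _; exact: (D_ge0 R A mul mulP _ DU).
have r0 : 0 < d / (1 + 6 * K) by rewrite divr_gt0 //; lra.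
have dE : (1 + 6 * K) * (d / (1 + 6 * K)) = d.
  by rewrite mulrC divfK // gt_eqF //; lra.
have A2z : A2 (fun f => 2 * z f).
  have [Az _] := zP; have := A2_lin R A mul mulP 2 0 _ _ Az Az.
  by congr (inAdd _); apply/funext => f; rewrite mul0r addr0.
have ur : bn (fun g => g one - 2 * z g) <= 1 + d / (1 + 6 * K).
  by apply: le_trans FAdd_double_z _; rewrite lerDl ltW.
have [a [Fa fa]] := dense_FA R A mul mulP A_unital z zP 'I_1 _ (fun _ => U) _
  A2z r0 ur (fun _ => DU).
(* Halving $|U(a) - 2z(U)| < d$ puts $U(a/2)$ within $d/2$ of [F T0], against $\mathrm{Re}\,F \ge d$
   on $C$. *)
have {fa} := fa ord0; rewrite -/K dE.
have a2 : 2 *: (2^-1 *: a) = a by rewrite scalerA divff ?scale1r // pnatr_eq0.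
have FAa : FA mul (2 *: (2^-1 *: a)) by rewrite a2.
have := Fd _ (ex_intro _ (2^-1 *: a) (conj FAa erefl)).
have -> : U (emb a) = 2 * U (emb (2^-1 *: a)).
  rewrite -(D_scale R A mul) //; congr U.
  by congr (_, _); rewrite /= ?a2 ?scaler0.
rewrite -FB -[F (T _)]/(U _) zU -mulrBr absCM.
have -> : absC (2 : R[i]) = 2 by rewrite -(absC_nneg R 2) // rmorph_nat.
have := Re_le_absC _ (U (emb (2^-1 *: a)) - F T0); lra.
Qed.

(** The net is indexed by finite lists, ordered by inclusion together with length: the members are
    the elements to be almost fixed, and the length sets the precision. *)
Lemma cai_in_half_FA : exists (J : Type) (le' : J -> J -> Prop) (f : J -> A),
  is_cai mul le' f /\ forall t, FA mul (2 *: f t).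
Proof.
pose P (s : seq A) x := FA mul (2 *: x) /\ forall b, b \in s ->
  nA (mul x b - b) < (size s).+1%:R^-1 /\ nA (mul b x - b) < (size s).+1%:R^-1.
have hP s : exists x, P s x by apply: half_FA_unit; rewrite invr_gt0 ltr0Sn.
have [f fP] := choice hP.
exists (seq A), (fun s t => {subset s <= t} /\ (size s <= size t)%N), f.
split; last by move=> s; case: (fP s).
split.
- split; first by exists [::].
  + by move=> s; split.
  + move=> s t u [st nst] [tu ntu]; split; last exact: leq_trans nst ntu.
    by move=> x /st /tu.
  + move=> s t; exists (s ++ t); rewrite size_cat leq_addr leq_addl.
    by split; split => // x; rewrite mem_cat => ->; rewrite ?orbT.
(* Contractivity: $\|2x\| \le \|1\| + \|1 - 2x\| \le 2$. *)
- move=> s; have [/FAE Fs _] := fP s.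
  have : N (emb (2 *: f s)) <= N one + N (one - emb (2 *: f s)).
    rewrite -(unormN R A mul mulP (one - _)).
    apply: le_trans (unormD R A mul mulP _ _).
    by rewrite opprB addrC subrK.
  rewrite (unorm_emb R A mul mulP A_unital) nAZ.
  have -> : absC (2 : R[i]) = 2 by rewrite -(absC_nneg R 2) // rmorph_nat.
  by have := unorm_one R A mul mulP; lra.
- move=> a.
  have key (eps : R) : 0 < eps -> exists t0 : seq A, forall t,
      {subset t0 <= t} /\ (size t0 <= size t)%N ->
      nA (mul (f t) a - a) < eps /\ nA (mul a (f t) - a) < eps.
    (* Repeating [a] makes the list long enough for precision [eps]. *)
    move=> e0; pose n := Num.bound eps^-1; exists (nseq n.+1 a) => t [at_ nt].
    have [_ /(_ a)[]] := fP t; first by apply: at_; rewrite mem_nseq eqxx.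
    have small : (size t).+1%:R^-1 < eps.
      rewrite -[eps]invrK ltf_pV2 ?posrE ?invr_gt0 ?ltr0Sn //.
      apply: lt_le_trans (archi_boundP _) _; first by rewrite invr_ge0 ltW.
      by rewrite ler_nat -/n; rewrite size_nseq in nt; exact: leqW (ltnW nt).
    by move=> h1 h2; split; [exact: lt_trans h1 small|exact: lt_trans h2 small].
  by split=> eps e0; have [t0 ht] := key eps e0; exists t0 => t /ht[].
Qed.

End ApproximateIdentity.

Theorem theorem5p2 (R : realType) (A : completeNormedModType R[i])
    (mul : A -> A -> A) :
  is_banach_algebra mul -> M_approx_unital mul ->
  [/\ @wstar_dense R (A1 mul) (fun x => exists a, x = jA mul a /\ FA mul a) (@FAdd R A mul),
      @wstar_dense R (A1 mul) (fun x => exists a, x = jA mul a /\ rA mul a) (@rAdd R A mul) &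
      exists (I : Type) (le : I -> I -> Prop) (e : I -> A),
        is_cai mul le e /\ forall t, FA mul (2 *: e t)].
Proof.
move=> mulP [Au Mideal]; have [z zP] := M_ideal_projection _ _ _ mulP Mideal.
split; [exact: FA_dense zP|exact: rA_dense zP|].
have [I [le [e e_cai]]] := Au; exact: cai_in_half_FA e_cai _ zP.
Qed.
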